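(* The logic $\mathrm{S2S}+\forall^{=1}$ has an undecidable theory.
   Context: $\mathrm{S2S}$ is monadic second-order logic of the full binary tree $(\{\mathtt{L},\mathtt{R}\}^\ast,\mathrm{succ}_L,\mathrm{succ}_R)$ where $\mathrm{succ}_L=\{(w,w\mathtt{L})\}$ and $\mathrm{succ}_R=\{(w,w\mathtt{R})\}$: formulas are built from atoms $\mathrm{succ}_L(x,y)$, $\mathrm{succ}_R(x,y)$, $x\in X$ using $\neg$, $\vee$, first-order quantification over vertices and second-order quantification over sets of vertices. Sets of vertices are identified with trees in $T_{\{0,1\}}=\{0,1\}^{\{\mathtt{L},\mathtt{R}\}^\ast}$. $\mathrm{S2S}+\forall^{=1}$ adds the quantifier $\forall^{=1}X.\,\phi$: a tuple $t$ satisfies $\forall^{=1}X.\,\phi(X,Y_1,\dots,Y_n)$ iff $\mu_t(\{t'\in T_{\{0,1\}}\mid (t',t)\text{ satisfies }\phi\})=1$, where $\mu_t$ is the product probability measure on $T_{\{0,1\}}$ labelling each vertex independently by $0$ or $1$ with probability $\tfrac12$. The theory is the set of sentences true in the full binary tree. *)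

(* Defs.v *)
From HB Require Import structures.
From mathcomp Require Import all_boot all_order all_algebra.
From mathcomp Require Import all_classical all_reals all_analysis.
From mathcomp Require Import ring lra zify.
Import Order.TTheory GRing.Theory Num.Theory.
Import numFieldNormedType.Exports.

Set Implicit Arguments.
Unset Strict Implicit.
Unset Printing Implicit Defensive.

Local Open Scope classical_set_scope.
Local Open Scope ring_scope.

(* A vertex is a finite word over {L, R}, its first letter being the first
   move from the root. *)
Definition vertex : Type := seq bool.
Definition dirL : bool := false.
Definition dirR : bool := true.
Definition succL (x y : vertex) : bool := y == rcons x dirL.
Definition succR (x y : vertex) : bool := y == rcons x dirR.

(* A set of vertices is identified with its characteristic function. *)
Definition tree : Type := vertex -> bool.

(* The product sigma-algebra, generated by the coordinates. *)
Definition coordinate_sets : set (set tree) :=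
  range (fun v => [set t : tree | t v]).

HB.instance Definition _ :=
  Measurable.copy tree (g_sigma_algebraType coordinate_sets).

Lemma measurable_coordinate (v : vertex) (b : bool) :
  measurable [set t : tree | t v = b].
Proof.
have mT : measurable [set t : tree | t v].
  by apply: sub_sigma_algebra; exists v.
case: b; first exact: mT.
rewrite (_ : [set _ | _] = ~` [set t : tree | t v]); first exact: measurableC.
by apply/seteqP; split=> t /=; case: (t v).
Qed.

(* The product measure is realized as the law of the tree whose label at [v]
   is the binary digit of index [pickle v] of a uniform random point of [0, 1[
   ([pickle] numbers the vertices injectively).  [coin_measure_cylinder] and
   [coin_measure_unique] below show that this is the product measure. *)

Section coin_measure.
Context (R : realType).
Implicit Types (x : R) (b : nat -> bool) (s : seq nat).

Definition digit x (n : nat) : bool := odd (Num.truncn (2 ^+ n.+1 * x)).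

Definition digit_tree (x : measurableTypeR R) : tree := fun v => digit x (pickle v).

Lemma truncn_double x : 0 <= x -> (Num.truncn (2 * x))./2 = Num.truncn x.
Proof.
move=> x0; apply/esym/truncn_def.
have /truncn_itv/andP[] : 0 <= 2 * x by lra.
set m := Num.truncn _ => l u.
have h1 : ((m./2).*2%:R : R) <= m%:R by rewrite ler_nat; lia.
have h2 : (m.+1%:R : R) <= ((m./2).+1).*2%:R by rewrite ler_nat; lia.
move: h1 h2; rewrite -!mul2n !natrM => h1 h2; apply/andP; split; lra.
Qed.

Fixpoint prefix_value b (n : nat) : nat :=
  if n is n'.+1 then ((prefix_value b n').*2 + b n')%N else 0%N.

Lemma prefix_value_lt b n : (prefix_value b n < 2 ^ n)%N.
Proof. by elim: n => //= n; rewrite expnS; case: (b n); lia. Qed.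

Lemma digit_prefix x b n : 0 <= x < 1 ->
  (forall i, (i < n)%N -> digit x i = b i) <->
  Num.truncn (2 ^+ n * x) = prefix_value b n.
Proof.
move=> x01; have x0 : 0 <= x by lra.
elim: n => [|n [IH1 IH2]].
  by split=> // _; rewrite expr0 mul1r; exact: truncn_def.
have p0 : 0 <= 2 ^+ n * x by rewrite mulr_ge0// exprn_ge0.
have half := truncn_double p0; rewrite mulrA -exprS in half.
have od : digit x n = odd (Num.truncn (2 ^+ n.+1 * x)) by [].
split=> /= [h|h].
  have hn : digit x n = b n by exact: h.
  rewrite -IH1; last by move=> i lin; apply: h; exact: ltnW.
  by rewrite -half -hn od addnC odd_double_half.
have hn : digit x n = b n by rewrite od h oddD odd_double oddb.
move=> i; rewrite ltnS leq_eqVlt => /orP[/eqP->//|lin].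
apply: IH2 => //; rewrite -half h; case: (b n) => /=; lia.
Qed.

Lemma measurable_digit n (c : bool) : measurable [set x : R | digit x n = c].
Proof.
have mk (k : nat) :
    measurable [set x : R | Num.truncn (2 ^+ n.+1 * x) = k].
  have p0 : (0 : R) < 2 ^+ n.+1 by exact: exprn_gt0.
  have mitv : measurable (`[k%:R / 2 ^+ n.+1, k.+1%:R / 2 ^+ n.+1[%classic : set R).
    exact: measurable_itv.
  case: k mitv => [|k] mitv.
    rewrite (_ : [set _ | _] = `]-oo, (2 ^+ n.+1)^-1[%classic :> set R).
      exact: measurable_itv.
    apply/seteqP; split=> x /=; rewrite in_itv/= -[_^-1]mul1r ltr_pdivlMr// mulrC.
      by move=> h; rewrite ltNge -truncn_gt0 h.
    by rewrite ltNge -truncn_gt0 -eqn0Ngt => /eqP.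
  rewrite (_ : [set _ | _] =
      `[k.+1%:R / 2 ^+ n.+1, k.+2%:R / 2 ^+ n.+1[%classic :> set R)//.
  apply/seteqP; split=> x /=;
    rewrite in_itv/= ler_pdivrMr// ltr_pdivlMr// (mulrC x).
    move=> h; have : (0 < Num.truncn (2 ^+ n.+1 * x))%N by rewrite h.
    rewrite truncn_gt0 => h1.
    by rewrite -h truncn_itv//; lra.
  exact: truncn_def.
rewrite (_ : [set _ | _] = \bigcup_(k in [set k | odd k = c])
    [set x : R | Num.truncn (2 ^+ n.+1 * x) = k]).
  by apply: bigcup_measurable => k _; exact: mk.
apply/seteqP; split=> x /=.
  by move=> h; exists (Num.truncn (2 ^+ n.+1 * x)).
by move=> [k /= <- <-].
Qed.

Lemma measurable_digit_tree : measurable_fun setT digit_tree.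
Proof.
apply: (@measurability _ _ _ _ _ _ coordinate_sets) => //.
move=> _ [_ [v _ <-]] <-; rewrite setTI.
exact: (measurable_digit (pickle v) true).
Qed.

Definition uniform01 : set (measurableTypeR R) -> \bar R :=
  mrestr (@lebesgue_measure R) (measurable_itv `[0%R, 1%R[).

HB.instance Definition _ := Measure.on uniform01.

Lemma uniform01_setT : uniform01 setT = 1%E.
Proof.
by rewrite /uniform01 /mrestr setTI lebesgue_measure_itv/= lte01 oppr0 adde0.
Qed.

HB.instance Definition _ :=
  Measure_isProbability.Build _ _ _ uniform01 uniform01_setT.

HB.instance Definition _ :=
  isMeasurableFun.Build _ _ _ _ digit_tree measurable_digit_tree.

Definition coin_measure : probability tree R :=
  distribution uniform01 digit_tree.

Lemma uniform01_prefix b n :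
  uniform01 [set x | forall i, (i < n)%N -> digit x i = b i]
  = ((2 ^+ n)^-1)%:E.
Proof.
have p0 : (0 : R) < 2 ^+ n by exact: exprn_gt0.
rewrite /uniform01 /mrestr.
set k := prefix_value b n.
have k1 : (k.+1%:R : R) <= 2 ^+ n.
  by rewrite -natrX ler_nat; exact: prefix_value_lt.
have iP x : `[k%:R / 2 ^+ n, k.+1%:R / 2 ^+ n[%classic x <->
    (k%:R <= 2 ^+ n * x < k.+1%:R).
  by rewrite /= in_itv/= ler_pdivrMr// ltr_pdivlMr// (mulrC x).
rewrite (_ : _ `&` _ = `[k%:R / 2 ^+ n, k.+1%:R / 2 ^+ n[%classic).
  rewrite lebesgue_measure_itv/= lte_fin ltr_pM2r ?invr_gt0// ltr_nat ltnSn.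
  by rewrite -EFinB -mulrBl -natrB// subSnn mul1r.
apply/seteqP; split=> x /=.
  rewrite in_itv/= => -[h x01]; apply/iP.
  move/(digit_prefix b n x01) : h => h.
  by case/andP: x01 => x0 _; rewrite /k -h truncn_itv// mulr_ge0// ltW.
move=> /iP kx.
have x01 : 0 <= x < 1.
  case/andP: kx => kx xk; apply/andP; split.
    by rewrite -(pmulr_rge0 _ p0); exact: le_trans kx.
  by rewrite -(ltr_pM2l p0) mulr1; exact: lt_le_trans k1.
split; last by rewrite in_itv.
by apply/(digit_prefix b n x01); exact: truncn_def.
Qed.

Lemma measurable_digits b s :
  measurable [set x : R | forall i, i \in s -> digit x i = b i].
Proof.
rewrite (_ : [set _ | _] =
    \bigcap_(i in [set` s]) [set x | digit x i = b i]).
  by apply: fin_bigcap_measurable => // i _; exact: measurable_digit.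
by apply/seteqP; split=> x /= h i /=; exact: h.
Qed.

Lemma uniform01_digits b s : uniq s ->
  uniform01 [set x | forall i, i \in s -> digit x i = b i]
  = ((2 ^+ size s)^-1)%:E.
Proof.
have [N sN] : exists N, {subset s <= iota 0 N}.
  exists (\max_(i <- s) i.+1) => i si; rewrite mem_iota/= add0n.
  exact: (@leq_bigmax_seq _ s xpredT (fun i => i.+1) i).
have [m] := ubnP (N - size s)%N; elim: m => // m IH in b s sN *.
rewrite ltnS => szs us.
have [/allP sub|/allPn[j jN js]] := boolP (all (mem s) (iota 0 N)).
  have ss : s =i iota 0 N.
    by move=> i; apply/idP/idP; [exact: sN|exact: sub].
  have -> : size s = N.
    by rewrite (perm_size (uniq_perm us (iota_uniq 0 N) ss)) size_iota.
  rewrite -(uniform01_prefix b N); congr (uniform01 _).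
  by apply/seteqP; split=> x /= h i; have := h i; rewrite ss mem_iota.
have {}js : j \notin s by [].
have jsN : {subset j :: s <= iota 0 N}.
  by move=> i; rewrite inE => /predU1P[->//|]; exact: sN.
have ujs : uniq (j :: s) by rewrite /= us andbT.
have szjs : (size (j :: s) <= N)%N.
  by rewrite -[leqRHS](size_iota 0); exact: uniq_leq_size.
have szlt : (N - size (j :: s) < m)%N by move: szjs szs => /=; lia.
pose B c := fun i => if i == j then c else b i.
have BE c : [set x | forall i, i \in j :: s -> digit x i = B c i] =
    [set x | forall i, i \in s -> digit x i = b i] `&` [set x | digit x j = c].
  apply/seteqP; split=> x /=.
    move=> h; split=> [i si|].
      have := h i; rewrite /B inE si orbT => ->//.
      by case: eqP si => // ->; rewrite (negPf js).
    by have := h j; rewrite /B mem_head eqxx => ->.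
  move=> [h1 h2] i; rewrite /B inE; case: eqP => [->//|_/=]; exact: h1.
rewrite (_ : [set x | forall i, i \in s -> digit x i = b i] =
    [set x | forall i, i \in j :: s -> digit x i = B true i] `|`
    [set x | forall i, i \in j :: s -> digit x i = B false i]); last first.
  rewrite !BE -setIUr; apply/seteqP; split=> x /=; last by case.
  by split=> //; case: digit; [left|right].
rewrite measureU; [|exact: measurable_digits|exact: measurable_digits|].
  transitivity ((2 ^+ size (j :: s))^-1%:E + (2 ^+ size (j :: s))^-1%:E : \bar R)%E.
    by congr (_ + _)%E; exact: IH.
  rewrite -EFinD/= exprS; congr EFin.
  have : (2 ^+ size s : R) != 0 by rewrite expf_neq0.
  by move=> ?; field.
by rewrite !BE; apply/seteqP; split=> x //= [[_ ->] [_]].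
Qed.

Lemma coin_measure_cylinder (s : seq vertex) (t0 : tree) : uniq s ->
  coin_measure [set t | forall v, v \in s -> t v = t0 v]
  = ((2 ^+ size s)^-1)%:E.
Proof.
move=> us; pose b i := odflt false (omap t0 (unpickle i)).
rewrite -(size_map pickle) -(@uniform01_digits b); last first.
  by rewrite map_inj_uniq//; exact: (pcan_inj pickleK).
congr (uniform01 _); apply/seteqP; split=> x /= h.
  by move=> _ /mapP[v sv ->]; rewrite /b pickleK/= -h.
by move=> v sv; rewrite /digit_tree h ?map_f// /b pickleK.
Qed.

Lemma coin_measure_unique (P : probability tree R) :
  (forall (s : seq vertex) (t0 : tree), uniq s ->
    P [set t | forall v, v \in s -> t v = t0 v] = ((2 ^+ size s)^-1)%:E) ->
  forall A, measurable A -> P A = coin_measure A.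
Proof.
move=> Pcyl A mA.
pose cyl (s : seq vertex) : set tree := [set t | forall v, v \in s -> t v].
have mcyl (s : seq vertex) : measurable (cyl s).
  rewrite (_ : cyl s = \bigcap_(v in [set` s]) [set t | t v = true]).
    by apply: fin_bigcap_measurable => // v _; exact: measurable_coordinate.
  by apply/seteqP; split=> t /= h v /=; exact: h.
apply: (@measure_unique _ R tree (range cyl) (fun=> cyl [::])) => //.
- apply/seteqP; split; last first.
    apply: smallest_sub => [|_ [s _ <-]]; last exact: mcyl.
    exact: sigma_algebra_measurable.
  apply: smallest_sub; first exact: smallest_sigma_algebra.
  move=> _ [v _ <-]; apply: sub_sigma_algebra; exists [:: v] => //.
  apply/seteqP; split=> t /=; first by apply; rewrite mem_head.
  by move=> tv w; rewrite inE => /eqP ->.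
- move=> _ _ [s _ <-] [s' _ <-]; exists (s ++ s') => //.
  apply/seteqP; split=> t /=.
    by move=> h; split=> v sv; apply: h; rewrite mem_cat sv ?orbT.
  by move=> [h1 h2] v; rewrite mem_cat => /orP[/h1|/h2].
- by apply/seteqP; split=> // t _; exists 0%N.
- move=> _ [s _ <-].
  have -> : cyl s = [set t | forall v, v \in undup s -> t v = true].
    by apply/seteqP; split=> t /= h v; have := h v; rewrite mem_undup.
  apply: etrans (Pcyl _ (fun=> true) (undup_uniq s)) _.
  exact/esym/(coin_measure_cylinder (fun=> true))/undup_uniq.
- by move=> _; apply: le_lt_trans (probability_le1 _ _) (ltry 1).
Qed.

(* "[coin_measure A = 1]" for a set that need not be Borel: [A] is measurable
   for the completion of [coin_measure] and has measure one for it. *)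
Lemma ae_coin_measureP (A : set tree) :
  (\forall t \ae coin_measure, A t) <->
  exists B, [/\ measurable B, B `<=` A & coin_measure B = 1%E].
Proof.
split=> [[N [mN N0 AN]]|[B [mB BA B1]]].
  exists (~` N); split; first exact: measurableC.
    by move=> t Nt; apply: contrapT => /AN.
  by rewrite probability_setC// N0 sube0.
exists (~` B); split; first exact: measurableC.
  by rewrite probability_setC// B1 subee.
exact: subsetC.
Qed.

End coin_measure.

(* First-order and second-order variables are two disjoint countable supplies,
   both indexed by [nat].  Conjunction and the existential quantifiers are
   definable. *)
Inductive formula : Type :=
| SuccL (x y : nat)
| SuccR (x y : nat)
| In (x X : nat)
| Not (phi : formula)
| Or (phi psi : formula)
| Forall1 (x : nat) (phi : formula)
| Forall2 (X : nat) (phi : formula)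
| ForallMeasure1 (X : nat) (phi : formula).

Fixpoint free1 (phi : formula) : seq nat :=
  match phi with
  | SuccL x y | SuccR x y => [:: x; y]
  | In x _ => [:: x]
  | Not phi | Forall2 _ phi | ForallMeasure1 _ phi => free1 phi
  | Or phi psi => free1 phi ++ free1 psi
  | Forall1 x phi => [seq y <- free1 phi | y != x]
  end.

Fixpoint free2 (phi : formula) : seq nat :=
  match phi with
  | SuccL _ _ | SuccR _ _ => [::]
  | In _ X => [:: X]
  | Not phi | Forall1 _ phi => free2 phi
  | Or phi psi => free2 phi ++ free2 psi
  | Forall2 X phi | ForallMeasure1 X phi => [seq Y <- free2 phi | Y != X]
  end.

Definition sentence (phi : formula) : bool :=
  (free1 phi == [::]) && (free2 phi == [::]).

Definition update (T : Type) (e : nat -> T) (x : nat) (a : T) : nat -> T :=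
  fun y => if y == x then a else e y.

(* The value of the measure quantifier is decided by the completed coin-flipping
   measure (see [ae_coin_measureP]); if the set defined by the body is not
   measurable then it does not have measure one, and the formula is false. *)
Fixpoint sat (R : realType) (e : nat -> vertex) (E : nat -> tree)
    (phi : formula) : Prop :=
  match phi with
  | SuccL x y => succL (e x) (e y)
  | SuccR x y => succR (e x) (e y)
  | In x X => E X (e x)
  | Not phi => ~ sat R e E phi
  | Or phi psi => sat R e E phi \/ sat R e E psi
  | Forall1 x phi => forall v : vertex, sat R (update e x v) E phi
  | Forall2 X phi => forall t : tree, sat R e (update E X t) phi
  | ForallMeasure1 X phi =>
      \forall t \ae coin_measure R, sat R e (update E X t) phi
  end.

Lemma eq_sat (R : realType) (phi : formula) e e' E E' :
  {in free1 phi, e =1 e'} -> {in free2 phi, E =1 E'} ->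
  sat R e E phi <-> sat R e' E' phi.
Proof.
have upd T (f g : nat -> T) x a s :
    {in [seq y <- s | y != x], f =1 g} -> {in s, update f x a =1 update g x a}.
  move=> fg y ys; rewrite /update; case: eqP => // /eqP yx.
  by apply: fg; rewrite mem_filter yx.
elim: phi e e' E E' => [x y|x y|x X|phi IH|phi IHl psi IHr|x phi IH|X phi IH
    |X phi IH] e e' E E' /= h1 h2.
- by rewrite !h1// !inE eqxx ?orbT.
- by rewrite !h1// !inE eqxx ?orbT.
- by rewrite h1 ?h2// inE.
- by rewrite (IH _ _ _ _ h1 h2).
- rewrite (IHl e e' E E') ?(IHr e e' E E')//.
  + by move=> y ys; apply: h1; rewrite mem_cat ys orbT.
  + by move=> y ys; apply: h2; rewrite mem_cat ys orbT.
  + by move=> y ys; apply: h1; rewrite mem_cat ys.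
  + by move=> y ys; apply: h2; rewrite mem_cat ys.
- by split=> h v; apply/(IH _ _ _ _ (upd _ _ _ _ _ _ h1) h2); exact: h.
- by split=> h t; apply/(IH _ _ _ _ h1 (upd _ _ _ _ _ _ h2)); exact: h.
- split; apply: filterS => t h;
    by apply/(IH _ _ _ _ h1 (upd _ _ _ _ _ _ h2)).
Qed.

(* By [eq_sat], the truth of a sentence does not depend on the valuation. *)
Definition theory (R : realType) : set formula :=
  [set phi | sentence phi /\ forall e E, sat R e E phi].

(* Codes of partial recursive functions.  Arguments are passed as a list, a
   missing argument of [Succ] or [Proj] being read as [0]. *)
Inductive recfun : Type :=
| Zero
| Succ
| Proj (i : nat)
| Comp (f : recfun) (gs : seq recfun)
| PrimRec (f g : recfun)
| Mu (f : recfun).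

(* [computes f xs y]: the partial recursive function [f] is defined at [xs],
   with value [y]. *)
Inductive computes : recfun -> seq nat -> nat -> Prop :=
| computes_zero xs : computes Zero xs 0
| computes_succ xs : computes Succ xs (nth 0%N xs 0).+1
| computes_proj i xs : computes (Proj i) xs (nth 0%N xs i)
| computes_comp f gs xs ys z :
    size ys = size gs ->
    (forall i, (i < size gs)%N -> computes (nth Zero gs i) xs (nth 0%N ys i)) ->
    computes f ys z ->
    computes (Comp f gs) xs z
| computes_primrec0 f g xs y :
    computes f xs y ->
    computes (PrimRec f g) (0%N :: xs) y
| computes_primrecS f g n xs r y :
    computes (PrimRec f g) (n :: xs) r ->
    computes g (n :: r :: xs) y ->
    computes (PrimRec f g) (n.+1 :: xs) y
| computes_mu f xs n (ys : nat -> nat) :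
    (forall m, (m < n)%N -> computes f (m :: xs) (ys m).+1) ->
    computes f (n :: xs) 0 ->
    computes (Mu f) xs n.

Lemma computes_functional f xs y z : computes f xs y -> computes f xs z -> y = z.
Proof.
move=> h; elim: h z => {f xs y}.
- by move=> xs z h; inversion h.
- by move=> xs z h; inversion h.
- by move=> i xs z h; inversion h.
- move=> f gs xs ys y sz _ IHgs _ IHf z h.
  inversion h as [| | |? ? ? ys' ? sz' hgs hf| | |]; subst.
  apply: IHf; rewrite (_ : ys = ys')//.
  apply: (@eq_from_nth _ 0%N); first by rewrite sz sz'.
  by move=> i; rewrite sz => ilt; apply: IHgs => //; exact: hgs.
- by move=> f g xs y _ IH z h; inversion h; subst; exact: IH.
- move=> f g n xs r y _ IHr _ IHg z h.
  inversion h as [| | | | |? ? ? ? r' ? hr hg|]; subst.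
  by apply: IHg; rewrite (IHr _ hr).
- move=> f xs n ys _ IHlt _ IHn z h.
  inversion h as [| | | | | |? ? ? ys' hlt hn]; subst.
  case: (ltngtP n z) => // [nz|zn].
    by have := IHn _ (hlt _ nz).
  by have := IHlt _ zn _ hn.
Qed.

Definition recursive (A : set nat) : Prop :=
  exists f, forall n,
    (A n -> computes f [:: n] 1) /\ (~ A n -> computes f [:: n] 0).

Fixpoint godel (phi : formula) : nat :=
  match phi with
  | SuccL x y => CodeSeq.code [:: 0; x; y]
  | SuccR x y => CodeSeq.code [:: 1; x; y]
  | In x X => CodeSeq.code [:: 2; x; X]
  | Not phi => CodeSeq.code [:: 3; godel phi]
  | Or phi psi => CodeSeq.code [:: 4; godel phi; godel psi]
  | Forall1 x phi => CodeSeq.code [:: 5; x; godel phi]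
  | Forall2 X phi => CodeSeq.code [:: 6; X; godel phi]
  | ForallMeasure1 X phi => CodeSeq.code [:: 7; X; godel phi]
  end%N.

Lemma godel_inj : injective godel.
Proof.
have cI := can_inj CodeSeq.codeK.
elim=> [x y|x y|x X|phi IH|phi IH psi IH'|x phi IH|X phi IH|X phi IH];
  case=> [x' y'|x' y'|x' X'|phi'|phi' psi'|x' phi'|X' phi'|X' phi'] /cI [] //.
- by move=> -> ->.
- by move=> -> ->.
- by move=> -> ->.
- by move=> /IH ->.
- by move=> /IH -> /IH' ->.
- by move=> -> /IH ->.
- by move=> -> /IH ->.
- by move=> -> /IH ->.
Qed.

Definition decidable_theory (L : set formula) : Prop :=
  recursive [set godel phi | phi in L].

(* Main.v *)
Require Import Defs.
From mathcomp Require Import all_boot all_order all_algebra.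
From mathcomp Require Import all_classical all_reals all_analysis.
From mathcomp Require Import ring lra zify.
Import Order.TTheory GRing.Theory Num.Theory.
Import numFieldNormedType.Exports.

Set Implicit Arguments.
Unset Strict Implicit.
Unset Printing Implicit Defensive.

Local Open Scope classical_set_scope.
Local Open Scope ring_scope.

(* Everything takes place on the leftmost branch, a copy of the natural numbers.
   By the Borel-Cantelli lemmas, for disjoint finite sets C_0, C_1, ... of
   positions, almost every X contains infinitely many C_i iff the sum of the
   2^-|C_i| diverges.  Since the C_i may be quantified over, this detects whether
   a set Y of positions eventually has constant gaps: if gaps a < b follow each
   other infinitely often, group these occurrences in such a way that the groups of
   a-gaps have a divergent sum and those of b-gaps a convergent one.
   A number n is thus represented by a set with eventual gap n+1.  Order is
   definable by comparing gaps, and finite binary relations are definable as the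
   pairs of consecutive gaps that occur infinitely often in a set; hence the graph
   of every recursive function is definable.  As substitution of a numeral into a
   formula is recursive on codes, a recursive theory would contradict Tarski's
   theorem on the undefinability of truth. *)

(** * Borel-Cantelli lemmas for the coin-flipping measure *)

Section Coin.
Context (R : realType).
Local Notation mu := (coin_measure R).

Lemma ae_imp (P Q : tree -> Prop) : (forall t, P t -> Q t) ->
  (\forall t \ae mu, P t) -> \forall t \ae mu, Q t.
Proof. by move=> PQ; exact: filterS. Qed.

Definition cyl (D : seq vertex) : set tree := [set t | forall v, v \in D -> t v].

Lemma measurable_cyl D : measurable (cyl D).
Proof.
rewrite (_ : cyl D = \bigcap_(v in [set` D]) [set t | t v = true]).
  by apply: fin_bigcap_measurable => // v _; exact: measurable_coordinate.
by apply/seteqP; split=> t /= h v /=; exact: h.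
Qed.

Lemma coin_measure_cyl D : uniq D -> mu (cyl D) = ((2 ^+ size D)^-1)%:E.
Proof. exact: (coin_measure_cylinder R (fun=> true)). Qed.

Lemma cyl_cat D D' : cyl (D ++ D') = cyl D `&` cyl D'.
Proof.
apply/seteqP; split=> t /=.
  by move=> h; split=> v vD; apply: h; rewrite mem_cat vD ?orbT.
by move=> [h h'] v; rewrite mem_cat => /orP[/h|/h'].
Qed.

Definition avoid (C : nat -> seq vertex) (M : nat) : set tree :=
  [set t | forall i, (i < M)%N -> ~ cyl (C i) t].

Lemma avoidS C M : avoid C M.+1 = avoid C M `\` cyl (C M).
Proof.
apply/seteqP; split=> t /=.
  by move=> h; split=> [i iM|]; apply: h => //; exact: ltnW.
by move=> [h1 h2] i; rewrite ltnS leq_eqVlt => /orP[/eqP->|/h1].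
Qed.

Lemma measurable_avoid C M : measurable (avoid C M).
Proof.
elim: M => [|M IH].
  by rewrite (_ : avoid C 0 = setT)//; apply/seteqP; split=> t.
by rewrite avoidS; apply: measurableD => //; exact: measurable_cyl.
Qed.

Lemma coin_measure_avoid_cyl C M D :
  (forall i, (i < M)%N -> uniq (C i)) -> uniq D ->
  (forall i j v, (i < j < M)%N -> v \in C i -> v \notin C j) ->
  (forall i v, (i < M)%N -> v \in C i -> v \notin D) ->
  mu (avoid C M `&` cyl D) =
  (\prod_(i < M) (1 - (2 ^+ size (C i))^-1) * (2 ^+ size D)^-1)%:E.
Proof.
elim: M D => [|M IH] D uC uD dC dD.
  rewrite (_ : avoid C 0 = setT) ?setTI; last by apply/seteqP; split=> t.
  by rewrite big_ord0 mul1r coin_measure_cyl.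
have -> : avoid C M.+1 `&` cyl D =
    (avoid C M `&` cyl D) `\` (avoid C M `&` cyl (C M ++ D)).
  rewrite avoidS cyl_cat; apply/seteqP; split=> t /=.
    by move=> [[h1 h2] h3]; split=> // -[_ []].
  by move=> [[h1 h2] h3]; do !split => //; move=> h4; apply: h3.
have mA : measurable (avoid C M `&` cyl D).
  by apply: measurableI; [exact: measurable_avoid|exact: measurable_cyl].
have mB : measurable (avoid C M `&` cyl (C M ++ D)).
  by apply: measurableI; [exact: measurable_avoid|exact: measurable_cyl].
have dMC i v : (i < M)%N -> v \in C i -> v \notin C M ++ D.
  move=> iM vC; rewrite mem_cat negb_or (dC i M) ?iM//=.
  by apply: (dD i) => //; exact: ltnW.
have uMD : uniq (C M ++ D).
  rewrite cat_uniq uC// uD andbT/=; apply/hasPn => v vD; apply/negP => vC.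
  by have := dD _ _ (ltnSn M) vC; rewrite vD.
set A := avoid C M `&` cyl D in mA *; set B := avoid C M `&` cyl _ in mB *.
have BA : A `&` B = B.
  by apply: setIidr; rewrite /A /B cyl_cat => t [? []].
have -> : mu (A `\` B) = (mu A - mu B)%E.
  rewrite -[in RHS]BA; apply: measureD => //.
  by rewrite (le_lt_trans (probability_le1 _ _)) ?ltry.
have uC' i : (i < M)%N -> uniq (C i) by move=> ?; apply: uC; exact: ltnW.
have dC' i j v : (i < j < M)%N -> v \in C i -> v \notin C j.
  by move=> /andP[? ?]; apply: dC; apply/andP; split=> //; exact: ltnW.
have dD' i v : (i < M)%N -> v \in C i -> v \notin D.
  by move=> ?; apply: dD; exact: ltnW.
rewrite /A /B !IH// -EFinB big_ord_recr/=; congr EFin.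
rewrite size_cat exprD invfM; ring.
Qed.

Lemma prod_1B_le (p : nat -> R) M : (forall i, 0 <= p i <= 1) ->
  0 <= \prod_(i < M) (1 - p i) /\
  \prod_(i < M) (1 - p i) * (1 + \sum_(i < M) p i) <= 1.
Proof.
move=> p01; elim: M => [|M [IH1 IH2]].
  by rewrite !big_ord0 addr0 mulr1.
rewrite !big_ord_recr/=; have /andP[p0 p1] := p01 M.
move: IH1 IH2; set P := \prod_(i < M) _; set S := \sum_(i < M) _ => IH1 IH2.
have S0 : 0 <= S by apply: sumr_ge0 => i _; have /andP[] := p01 i.
split; first by rewrite mulr_ge0// subr_ge0.
have -> : P * (1 - p M) * (1 + (S + p M)) =
  P * (1 + S) - P * p M * S - P * p M ^+ 2 by ring.
have h1 : 0 <= P * p M * S by rewrite !mulr_ge0.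
have h2 : 0 <= P * p M ^+ 2 by rewrite mulr_ge0// exprn_ge0.
lra.
Qed.

(* The second Borel-Cantelli lemma. *)
Lemma ae_infinitely_often (C : nat -> seq vertex) :
  (forall i, uniq (C i)) ->
  (forall i j v, (i < j)%N -> v \in C i -> v \notin C j) ->
  (forall (K : nat), exists M, K%:R <= \sum_(i < M) (2 ^+ size (C i) : R)^-1) ->
  \forall t \ae mu, forall N, exists i, (N <= i)%N /\ cyl (C i) t.
Proof.
move=> uC dC sC; apply: ae_foralln => N.
pose C' i := C (N + i)%N; pose p i : R := (2 ^+ size (C' i))^-1.
have p01 i : 0 <= p i <= 1.
  rewrite /p invr_ge0 exprn_ge0//= invf_le1 ?exprn_gt0// exprn_ege1//.
  by rewrite ler1n.
have avE M : mu (avoid C' M) = (\prod_(i < M) (1 - p i))%:E.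
  have := @coin_measure_avoid_cyl C' M [::] (fun i _ => uC _) isT.
  rewrite (_ : cyl [::] = setT) ?setIT; last by apply/seteqP; split.
  rewrite expr0 invr1 mulr1; apply => // i j v /andP[ij _]; apply: dC.
  by rewrite ltn_add2l.
exists (\bigcap_M avoid C' M); split.
- by apply: bigcap_measurableType => M _; exact: measurable_avoid.
- apply/eqP; rewrite -measure_le0; apply/lee_addgt0Pr => e e0; rewrite add0e.
  have [K Ke] : exists K : nat, e^-1 <= K%:R.
    by exists (Num.truncn e^-1).+1; apply/ltW/truncnS_gt.
  have [M KM] := sC (K + N)%N.
  apply: (@le_trans _ _ (mu (avoid C' M))).
    apply: le_measure; rewrite ?inE; [|exact: measurable_avoid|].
      by apply: bigcap_measurableType => M' _; exact: measurable_avoid.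
    by move=> t /(_ M I).
  rewrite avE lee_fin; have [P0 P1] := prod_1B_le M p01.
  move: P0 P1; set P := \prod_(i < M) _; set S := \sum_(i < M) _ => P0 P1.
  have KS : K%:R <= S.
    have NM : \sum_(i < M) (2 ^+ size (C i) : R)^-1 <= N%:R + S.
      apply: (@le_trans _ _ (\sum_(i < N + M) (2 ^+ size (C i) : R)^-1)).
        rewrite (big_ord_widen_cond (N + M)%N xpredT
          (fun i => (2 ^+ size (C i) : R)^-1)) ?leq_addl//=.
        rewrite [leLHS]big_mkcond/=; apply: ler_sum => i _.
        by case: ifP => // _; rewrite invr_ge0 exprn_ge0.
      rewrite big_split_ord/= lerD2r//.
      apply: (@le_trans _ _ (\sum_(i < N) 1)); last first.
        by rewrite sumr_const card_ord.
      apply: ler_sum => i _; rewrite invf_le1 ?exprn_gt0// exprn_ege1//.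
      by rewrite ler1n.
    by move: KM; rewrite natrD; lra.
  have S0 : 0 <= S by apply: le_trans KS.
  have eS : 1 <= e * S.
    have : e^-1 <= S by apply: le_trans KS.
    by rewrite -(ler_pM2l e0) divff ?gt_eqF.
  rewrite leNgt; apply/negP => eP.
  have : e * S <= P * S by rewrite ler_wpM2r// ltW.
  lra.
- move=> t /= h M _ i iM cC; apply: h; exists (N + i)%N; split=> //.
  exact: leq_addr.
Qed.

Lemma not_ae_exists (C : nat -> seq vertex) :
  (forall i, uniq (C i)) ->
  (forall M, \sum_(i < M) (2 ^+ size (C i) : R)^-1 <= 2^-1) ->
  ~ \forall t \ae mu, exists i, cyl (C i) t.
Proof.
move=> uC sC [N [mN N0 CN]].
have : (1 <= (2^-1)%:E :> \bar R)%E; last by rewrite lee_fin; lra.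
rewrite -(@probability_setT _ tree R mu).
apply: (@le_trans _ _ (mu (~` N))).
  by rewrite probability_setC// N0 sube0 probability_setT.
apply: (@le_trans _ _ (\sum_(0 <= i <oo) mu (cyl (C i)))%E).
  apply: measure_sigma_subadditive.
  - by move=> i; exact: measurable_cyl.
  - exact: measurableC.
  - move=> t Nt; apply: contrapT => h; apply: Nt; apply: CN => /= -[i Ci].
    by apply: h; exists i.
apply: lime_le; first by apply: is_cvg_nneseries.
apply: nearW => M; rewrite big_mkord.
under eq_bigr do rewrite coin_measure_cyl//.
by rewrite sumEFin lee_fin.
Qed.

Lemma ae_relabel (f : vertex -> vertex) (P : set tree) : injective f ->
  (\forall t \ae mu, P t) -> \forall t \ae mu, P (t \o f).
Proof.
move=> fI [N [mN N0 PN]].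
have mf : measurable_fun setT (fun t : tree => t \o f : tree).
  apply: (@measurability _ _ _ _ _ _ coordinate_sets) => //.
  by move=> _ [_ [v _ <-]] <-; rewrite setTI; exact: (measurable_coordinate (f v) true).
pose F := mfun_Sub (mem_set mf : (fun t : tree => t \o f : tree) \in mfun).
exists ((fun t : tree => t \o f) @^-1` N); split.
- by rewrite -[X in measurable X]setTI; have h := mf; exact: h.
- rewrite -N0; apply: (@coin_measure_unique R (distribution mu F)) => // s t0 us.
  pose t1 : tree := fun w => t0 (nth [::] s (index w (map f s))).
  rewrite -(size_map f) -(coin_measure_cylinder R t1) ?map_inj_uniq//.
  congr (coin_measure R _); apply/seteqP; split=> t /= h v.
    move=> /mapP[w ws ->]; rewrite /t1 index_map// nth_index//; exact: h.
  move=> vs; have := h (f v); rewrite map_f// /t1 index_map// nth_index// => <-//.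
- by move=> t /= h; apply: PN.
Qed.

End Coin.

(** * The logic of the leftmost branch *)

Inductive lformula : Type :=
| LLt (x y : nat)
| LLe (x y : nat)
| LIn (x X : nat)
| LNot (phi : lformula)
| LAnd (phi psi : lformula)
| LImp (phi psi : lformula)
| LAll1 (x : nat) (phi : lformula)
| LEx1 (x : nat) (phi : lformula)
| LAll2 (X : nat) (phi : lformula)
| LEx2 (X : nat) (phi : lformula)
| LAe (X : nat) (phi : lformula).

Definition pos (k : nat) : vertex := nseq k dirL.
Definition branch (t : tree) : nat -> bool := t \o pos.

Fixpoint lsat (R : realType) (e : nat -> nat) (E : nat -> nat -> bool)
    (phi : lformula) : Prop :=
  match phi with
  | LLt x y => (e x < e y)%N
  | LLe x y => (e x <= e y)%N
  | LIn x X => E X (e x)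
  | LNot phi => ~ lsat R e E phi
  | LAnd phi psi => lsat R e E phi /\ lsat R e E psi
  | LImp phi psi => lsat R e E phi -> lsat R e E psi
  | LAll1 x phi => forall n, lsat R (update e x n) E phi
  | LEx1 x phi => exists n, lsat R (update e x n) E phi
  | LAll2 X phi => forall A, lsat R e (update E X A) phi
  | LEx2 X phi => exists A, lsat R e (update E X A) phi
  | LAe X phi =>
      \forall t \ae coin_measure R, lsat R e (update E X (branch t)) phi
  end.

Definition FImp phi psi := Or (Not phi) psi.
Definition FAnd phi psi := Not (Or (Not phi) (Not psi)).
Definition FEx1 x phi := Not (Forall1 x (Not phi)).
Definition FEx2 X phi := Not (Forall2 X (Not phi)).

(* The translation keeps the first-order variables 0, 1, 2 and the second-order
   variable 0 for its own use, whence the shifts by 3 and by 1. *)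
Definition closedL : formula :=
  Forall1 0 (Forall1 1 (FImp (SuccL 0 1) (FImp (In 0 0) (In 1 0)))).
Definition on_branch (x : nat) : formula :=
  Forall2 0 (FImp
    (FAnd (Forall1 0 (Or (In 0 0) (FEx1 1 (Or (SuccL 1 0) (SuccR 1 0))))) closedL)
    (In x 0)).
Definition ltL (x y : nat) : formula :=
  Forall2 0 (FImp
    (FAnd (Forall1 0 (FImp (SuccL x 0) (In 0 0))) closedL) (In y 0)).

Fixpoint tr (phi : lformula) : formula :=
  match phi with
  | LLt x y => ltL x.+3 y.+3
  | LLe x y => Not (ltL y.+3 x.+3)
  | LIn x X => In x.+3 X.+1
  | LNot phi => Not (tr phi)
  | LAnd phi psi => FAnd (tr phi) (tr psi)
  | LImp phi psi => FImp (tr phi) (tr psi)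
  | LAll1 x phi => Forall1 x.+3 (FImp (on_branch x.+3) (tr phi))
  | LEx1 x phi => FEx1 x.+3 (FAnd (on_branch x.+3) (tr phi))
  | LAll2 X phi => Forall2 X.+1 (tr phi)
  | LEx2 X phi => FEx2 X.+1 (tr phi)
  | LAe X phi => ForallMeasure1 X.+1 (tr phi)
  end.

Section Translation.
Context (R : realType).
Implicit Types (e : nat -> vertex) (E : nat -> tree).

Lemma sat_imp e E phi psi :
  sat R e E (FImp phi psi) = (sat R e E phi -> sat R e E psi).
Proof.
apply/propext; split=> /= [[]//|h]; case: (pselect (sat R e E phi)) => p; last by left.
by right; exact: h.
Qed.

Lemma sat_all1_at v e E x phi :
  sat R e E (Forall1 x phi) -> sat R (update e x v) E phi.
Proof. exact. Qed.

Lemma sat_all2_at t e E X phi :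
  sat R e E (Forall2 X phi) -> sat R e (update E X t) phi.
Proof. exact. Qed.

Lemma sat_all1I e E x phi :
  (forall v, sat R (update e x v) E phi) -> sat R e E (Forall1 x phi).
Proof. exact. Qed.

Lemma sat_all2I e E X phi :
  (forall t, sat R e (update E X t) phi) -> sat R e E (Forall2 X phi).
Proof. exact. Qed.

Lemma sat_and e E phi psi :
  sat R e E (FAnd phi psi) = (sat R e E phi /\ sat R e E psi).
Proof.
apply/propext; split=> /= [h|[p q] []//].
by split; apply: contrapT => p; apply: h; [left|right].
Qed.

Lemma sat_ex1 e E x phi :
  sat R e E (FEx1 x phi) <-> exists v, sat R (update e x v) E phi.
Proof.
split=> /= [h|[v h] /(_ v)//].
by apply: contrapT => n; apply: h => v p; apply: n; exists v.
Qed.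

Lemma sat_ex2 e E X phi :
  sat R e E (FEx2 X phi) <-> exists t, sat R e (update E X t) phi.
Proof.
split=> /= [h|[v h] /(_ v)//].
by apply: contrapT => n; apply: h => v p; apply: n; exists v.
Qed.

Lemma pos_rcons k : rcons (pos k) dirL = pos k.+1.
Proof. by rewrite /pos; elim: k => //= k ->. Qed.

Lemma pos_inj : injective pos.
Proof. by move=> i j /(congr1 size); rewrite !size_nseq. Qed.

Lemma sat_closedL e E : sat R e E closedL <->
  forall v, E 0 v -> E 0 (rcons v dirL).
Proof.
split=> [h v Ev|h].
  have /[!sat_imp] := sat_all1_at (rcons v dirL) (sat_all1_at v h); apply=> //; exact: eqxx.
apply: sat_all1I => v; apply: sat_all1I => w.
by rewrite !sat_imp => /eqP /= ->; exact: h.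
Qed.

Lemma sat_on_branch e E x :
  sat R e E (on_branch x.+3) <-> exists k, e x.+3 = pos k.
Proof.
split=> [h|[k ek]].
  have /[!sat_imp] h' := sat_all2_at (fun v => v == pos (size v)) h.
  suff : e x.+3 == pos (size (e x.+3)) by move=> /eqP ->; eexists.
  apply: h'; rewrite sat_and; split.
    move=> v /=; rewrite /update /=.
    case: (pselect (v == pos (size v))) => [|vN]; [by left|right].
    case: (lastP v) vN => [/(_ isT)//|w b _] h'.
    by apply: (h' w); rewrite /succL /succR; case: b {h'}; [right|left].
  apply/sat_closedL => v; rewrite /update /= => /eqP vp; rewrite size_rcons -pos_rcons.
  by rewrite [in X in X == _]vp.
apply: sat_all2I => t; rewrite sat_imp sat_and => -[h /sat_closedL h'].
rewrite /= /update /= ek; elim: k {ek} => [|k IH].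
  have [//|/= h0] := h [::].
  by exfalso; apply: h0 => v [] /eqP /(congr1 size); rewrite /update/= size_rcons.
by rewrite -pos_rcons; exact: h'.
Qed.

Lemma sat_ltL e E x y i j : e x.+3 = pos i -> e y.+3 = pos j ->
  sat R e E (ltL x.+3 y.+3) <-> (i < j)%N.
Proof.
move=> ei ej; split=> [h|ij].
  have /[!sat_imp] h' := sat_all2_at (fun v => (i < size v)%N) h.
  rewrite -(size_nseq j dirL) -[nseq _ _]ej; apply: h'.
  rewrite sat_and; split.
    apply: sat_all1I => v; rewrite sat_imp => /eqP /=; rewrite /update/= ei => ->.
    by rewrite size_rcons size_nseq.
  by apply/sat_closedL => v; rewrite /update/= size_rcons ltnS => /ltnW.
apply: sat_all2I => t; rewrite sat_imp sat_and => -[h /sat_closedL h'].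
rewrite /= /update /= ej; elim: j ij {ej} => // j IH.
rewrite ltnS leq_eqVlt -pos_rcons => /orP[/eqP <-|/IH]; last exact: h'.
by have /[!sat_imp] := sat_all1_at (rcons (pos i) dirL) h; apply; rewrite /= /update/= ei /succL.
Qed.

Lemma update_same (T : Type) (e : nat -> T) x a : update e x a x = a.
Proof. by rewrite /update eqxx. Qed.

Lemma update_branch E X t :
  (fun Y => branch (update E X.+1 t Y.+1)) =
  update (fun Y => branch (E Y.+1)) X (branch t).
Proof. by apply/funext => Y; rewrite /update eqSS; case: eqP. Qed.

Lemma branch_surj (A : nat -> bool) : exists t, branch t = A.
Proof.
exists (fun v => A (size v)); apply/funext => k.
by rewrite /branch/= size_nseq.
Qed.

Lemma sat_tr phi (le : nat -> nat) e E : (forall x, e x.+3 = pos (le x)) ->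
  sat R e E (tr phi) <-> lsat R le (fun X => branch (E X.+1)) phi.
Proof.
have upd (e0 : nat -> vertex) (le0 : nat -> nat) x n :
    (forall x, e0 x.+3 = pos (le0 x)) ->
    forall y, update e0 x.+3 (pos n) y.+3 = pos (update le0 x n y).
  by move=> h y; rewrite /update !eqSS; case: eqP.
elim: phi le e E => [x y|x y|x X|phi IH|phi IHl psi IHr|phi IHl psi IHr|x phi IH
    |x phi IH|X phi IH|X phi IH|X phi IH] le e E eP.
- exact: sat_ltL.
- have h := sat_ltL E (eP y) (eP x); rewrite [lsat _ _ _ _]/= leqNgt.
  by split=> [n|/negP n /h//]; apply/negP => /h.
- by rewrite /= eP.
- by rewrite /= (IH _ _ _ eP).
- by rewrite sat_and (IHl _ _ _ eP) (IHr _ _ _ eP).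
- by rewrite sat_imp (IHl _ _ _ eP) (IHr _ _ _ eP).
- split=> [h n|h].
    have /[!sat_imp] := sat_all1_at (pos n) h; rewrite  (IH _ _ _ (upd _ _ x n eP)); apply.
    by apply/sat_on_branch; exists n; rewrite update_same.
  apply: sat_all1I => v; rewrite sat_imp => /sat_on_branch[n]; rewrite update_same => ->.
  by rewrite (IH _ _ _ (upd _ _ x n eP)); exact: h.
- rewrite sat_ex1; split=> [[v]|[n h]].
    rewrite sat_and => -[/sat_on_branch[n]]; rewrite update_same => ->; rewrite (IH _ _ _ (upd _ _ x n eP)) => h.
    by exists n.
  exists (pos n); rewrite sat_and; split.
    by apply/sat_on_branch; exists n; rewrite update_same.
  by rewrite (IH _ _ _ (upd _ _ x n eP)).
- split=> [h A|h t].
    have [t <-] := branch_surj A.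
    by have /(IH _ _ _ eP) := h t; rewrite update_branch.
  by apply/(IH _ _ _ eP); rewrite update_branch; exact: h.
- rewrite sat_ex2; split=> [[t]|[A]].
    by rewrite (IH _ _ _ eP) update_branch => h; eexists; exact: h.
  have [t <-] := branch_surj A => h; exists t.
  by rewrite (IH _ _ _ eP) update_branch.
- split; apply: filterS => t.
    by move=> /(IH _ _ _ eP); rewrite update_branch.
  by move=> h; apply/(IH _ _ _ eP); rewrite update_branch.
Qed.

End Translation.

Local Open Scope nat_scope.

(** * Sets with eventually constant gaps *)

Definition infinitely (P : nat -> Prop) := forall n, exists m, n < m /\ P m.
Definition sub (A B : nat -> bool) := forall x, A x -> B x.
Definition gapfree (A : nat -> bool) x z :=
  forall w, x < w -> w <= z -> ~ A w.
(* [z] lies in the gap of [Y] that starts at some [s] in [S]. *)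
Definition block (Y S : nat -> bool) z :=
  exists s, S s /\ s <= z /\ gapfree Y s z.
Definition hit (Y S G Z : nat -> bool) g :=
  forall z, g <= z -> gapfree G g z -> block Y S z -> Z z.
Definition consec (Y : nat -> bool) y y' :=
  Y y /\ Y y' /\ y < y' /\ forall w, y < w -> w < y' -> ~ Y w.
Definition nexts (Y S S' : nat -> bool) :=
  sub S Y /\ sub S' Y /\
  forall y y', consec Y y y' -> (S y -> S' y') /\ (S' y' -> S y).

Section Tests.
Context (R : realType).

(* For [S] and [G] included in [Y], the points of [G] cut the positions into groups;
   [often_hit] says that the sum over all groups of [2 ^- l] diverges, where [l] is
   the total length of the gaps of [Y] that start in [S] and lie in the group. *)
Definition often_hit (Y S G : nat -> bool) : Prop :=
  \forall t \ae coin_measure R, forall x, exists g,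
    x < g /\ G g /\ hit Y S G (branch t) g.

(* The second clause makes the gaps of [Y] bounded, the third one prevents them from
   increasing infinitely often. *)
Definition ap (Y : nat -> bool) : Prop :=
  infinitely Y /\
  (forall G : nat -> bool, infinitely G -> sub G Y -> often_hit Y G G) /\
  (forall S S' G G' : nat -> bool, infinitely G -> nexts Y S S' -> nexts Y G G' ->
    often_hit Y S G -> often_hit Y S' G').

End Tests.

Definition num (Y : nat -> bool) n :=
  exists N r, forall i, N <= i -> Y i = (i == r %[mod n.+1]).

Lemma ninfinitely P : ~ infinitely P -> exists n, forall m, n < m -> ~ P m.
Proof.
move=> h; apply: contrapT => h'; apply: h => n; apply: contrapT => h''.
by apply: h'; exists n => m nm Pm; apply: h''; exists m.
Qed.

Lemma subsequence (P : nat -> nat -> Prop) :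
  (forall i, infinitely (P i)) ->
  exists h : nat -> nat, (forall i, h i < h i.+1) /\ forall i, P i (h i).
Proof.
move=> iP.
have [f fP] := choice (fun p : nat * nat => iP p.1 p.2).
exists (fix h i := if i is j.+1 then f (i, h j) else f (0, 0)); split.
  by move=> i; have [] := fP (i.+1, (fix h i := if i is j.+1 then f (i, h j) else f (0, 0)) i).
by case=> [|i]; [have [] := fP (0, 0)|have [] := fP (i.+1, (fix h i := if i is j.+1 then f (i, h j) else f (0, 0)) i)].
Qed.

Lemma pigeonhole (P : nat -> Prop) (f : nat -> nat) B :
  infinitely P -> (forall i, P i -> f i < B) ->
  exists c, infinitely (fun i => P i /\ f i = c).
Proof.
elim: B P => [|B IH] P iP fB.
  by have [i [_ /fB]] := iP 0.
case: (pselect (infinitely (fun i => P i /\ f i = B))) => [h|]; first by exists B.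
move=> /ninfinitely[n hn].
have [||c hc] := IH (fun i => P i /\ n < i).
  move=> m; have [k [mk Pk]] := iP (maxn m n); exists k.
  by move: mk; rewrite gtn_max => /andP[].
  move=> i [Pi ni]; have := fB _ Pi; rewrite ltnS leq_eqVlt => /orP[/eqP fi|//].
  by case: (hn _ ni).
by exists c => m; have [k [mk [[Pk _] fk]]] := hc m; exists k.
Qed.

Lemma enumerate (Y : nat -> bool) : infinitely Y ->
  exists y : nat -> nat, (forall i, y i < y i.+1) /\ forall x, Y x <-> exists i, x = y i.
Proof.
move=> iY.
have nx n : exists m, [&& n <= m, Y m & [forall k : 'I_m, (n <= k) ==> ~~ Y k]].
  have ex : exists m, (n <= m) && Y m.
    by have [m [nm Ym]] := iY n; exists m; rewrite ltnW.
  case: (ex_minnP ex) => m /andP[nm Ym] mmin; exists m; rewrite nm Ym/=.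
  apply/forallP => k; apply/implyP => nk; apply/negP => Yk.
  by have := mmin k; rewrite nk Yk leqNgt ltn_ord => /(_ isT).
have [f fP] := choice nx.
have {}fP n : [/\ n <= f n, Y (f n) & forall k, n <= k < f n -> ~~ Y k].
  have /and3P[h1 h2 /forallP h3] := fP n; split=> // k /andP[nk kf].
  by have /implyP := h3 (Ordinal kf); apply.
pose y := fix y i := if i is j.+1 then f (y j).+1 else f 0.
have yS i : y i < y i.+1 by have [] := fP (y i).+1.
exists y; split=> // x; split=> [Yx|[[|i] ->]]; last 2 first.
  by have [] := fP 0.
  by have [] := fP (y i).+1.
have [n xn] : exists n, x <= y n.
  exists x; elim: {Yx} x => // x IH; exact: leq_ltn_trans (yS x).
elim: n xn => [|n IH] xn.
  exists 0; apply/eqP; rewrite eqn_leq xn/= leqNgt; apply/negP => xf.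
  by have [_ _ /(_ x)] := fP 0; rewrite xf Yx => /(_ isT).
have [/IH//|nx'] := leqP x (y n); exists n.+1.
apply/eqP; rewrite eqn_leq xn/= leqNgt; apply/negP => xf.
by have [_ _ /(_ x)] := fP (y n).+1; rewrite nx' xf Yx => /(_ isT).
Qed.

Section Increasing.
Variables (y : nat -> nat).
Hypothesis yS : forall i, y i < y i.+1.

Lemma incr_lt i j : i < j -> y i < y j.
Proof. exact: (homo_ltn (r := fun a b => a < b) ltn_trans yS). Qed.

Lemma incr_le i j : i <= j -> y i <= y j.
Proof. by rewrite leq_eqVlt => /orP[/eqP->//|/incr_lt/ltnW]. Qed.

Lemma incr_ltE i j : (y i < y j) = (i < j).
Proof.
apply/idP/idP; last exact: incr_lt.
by apply: contraLR; rewrite -!leqNgt; exact: incr_le.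
Qed.

Lemma incr_inj i j : y i = y j -> i = j.
Proof. by move=> ij; case: (ltngtP i j) => // /incr_lt; rewrite ij ltnn. Qed.

Lemma incr_ge i : i <= y i.
Proof. by elim: i => // i /leq_ltn_trans; apply. Qed.

Lemma consec_image (Y : nat -> bool) : (forall x, Y x <-> exists i, x = y i) ->
  forall u v, consec Y u v <-> exists i, u = y i /\ v = y i.+1.
Proof.
move=> YE u v; split=> [[/YE[i ->] [/YE[j ->] [ij h]]]|[i [-> ->]]].
  exists i; split=> //.
  move: ij; rewrite incr_ltE leq_eqVlt => /orP[/eqP ->//|ij].
  by exfalso; apply: (h (y i.+1)); rewrite ?incr_ltE//; apply/YE; exists i.+1.
split; first by apply/YE; exists i.
split; first by apply/YE; exists i.+1.
split=> // w iw wi /YE[j wj]; move: iw wi; rewrite wj !incr_ltE; lia.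
Qed.
End Increasing.

(* [q = 2 ^ a]; the group [j] with [q ^ L <= j < q ^ L.+1] has [L + 2] blocks, so
   that it has weight about [1 / j] for blocks of length [a]. *)
Lemma group_sizes (R : realType) a b : 0 < a -> a < b ->
  exists k : nat -> nat, [/\ forall i, 0 < k i,
    forall K : nat, exists M,
      (K%:R <= \sum_(i < M) (2 ^+ (a * k i) : R)^-1)%R &
    forall M, (\sum_(i < M) (2 ^+ (b * k i) : R)^-1 <= 2^-1)%R].
Proof.
move=> a0 ab; pose q := 2 ^ a.
have q1 : 1 < q by rewrite /q -{1}(expn0 2) ltn_exp2l.
pose k i := (trunc_log q i.+1).+2.
pose u c i : R := ((2 ^+ (c * k i))^-1)%R.
have kE L i : q ^ L <= i.+1 < q ^ L.+1 -> k i = L.+2.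
  by move=> h; rewrite /k (trunc_log_eq q1 h).
have u0 c i : (0 <= u c i)%R by rewrite /u invr_ge0 exprn_ge0.
pose U c M : R := (\sum_(i < M) u c i)%R.
have Ustep c L : U c (q ^ L.+1).-1 =
    (U c (q ^ L).-1 + (q ^ L.+1 - q ^ L)%:R * (2 ^+ (c * L.+2))^-1)%R.
  have qL : q ^ L <= q ^ L.+1 by rewrite leq_exp2l.
  have qL0 : 0 < q ^ L by rewrite expn_gt0 ltnW.
  rewrite /U -!(big_mkord xpredT (u c)).
  rewrite (@big_cat_nat _ _ _ (q ^ L).-1)//=; last by lia.
  congr (_ + _)%R; rewrite (eq_big_nat _ _ (F2 := fun=> ((2 ^+ (c * L.+2))^-1)%R)).
    rewrite big_const_nat iter_addr_0 mulr_natl; congr (_ *+ _)%R; lia.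
  move=> i /andP[i1 i2]; rewrite /u (kE L)//; apply/andP; split; lia.
have Umono c M M' : M <= M' -> (U c M <= U c M')%R.
  move=> MM; rewrite /U -!(big_mkord xpredT (u c)).
  by rewrite (@big_cat_nat _ _ _ M _ _ _ _ _ MM)//= lerDl sumr_ge0.
have qR L : ((q ^ L)%:R = (2 ^+ (a * L)) :> R)%R by rewrite /q -expnM natrX.
exists k; split=> // [K|M].
- have h L : (L%:R * (2 ^+ (a * 2))^-1 <= U a (q ^ L).-1)%R.
    elim: L => [|L IH]; first by rewrite /U big_ord0 mul0r.
    rewrite Ustep -natr1 mulrDl lerD//.
    have h : q ^ L <= q ^ L.+1 - q ^ L by rewrite expnS; move: q1; clear; nia.
    apply: (@le_trans _ _ ((q ^ L)%:R * (2 ^+ (a * L.+2))^-1)%R); last first.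
      by rewrite ler_wpM2r ?invr_ge0 ?exprn_ge0// ler_nat.
    rewrite qR (_ : a * L.+2 = a * L + a * 2); last by lia.
    rewrite exprD invfM mulrA divff ?mul1r//.
  have [n hn] : exists n : nat, (2 ^+ (a * 2) <= n%:R :> R)%R.
    by exists (2 ^ (a * 2)); rewrite natrX.
  exists (q ^ (K * n)).-1; apply: le_trans (h _).
  rewrite natrM -mulrA ler_peMr// ler_pdivlMr ?exprn_gt0// mul1r.
  exact: hn.
- apply: (@le_trans _ _ (U b (q ^ M).-1)).
    by apply: (Umono b); have := ltn_expl M q1; lia.
  suff h L : (U b (q ^ L).-1 <= 2^-1 * (1 - (2 ^+ L)^-1))%R.
    apply: le_trans (h M) _; have : (0 <= ((2:R) ^+ M)^-1)%R by rewrite invr_ge0 exprn_ge0.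
    lra.
  elim: L => [|L IH]; first by rewrite /U big_ord0 expr0 invr1 subrr mulr0.
  rewrite Ustep; apply: le_trans (lerD IH (_ : _ <= (2 ^+ L.+2)^-1)%R) _; last first.
    by rewrite !exprS !invfM; lra.
  apply: (@le_trans _ _ ((q ^ L.+1)%:R * (2 ^+ (a.+1 * L.+2))^-1)%R).
    apply: ler_pM; rewrite ?ler0n ?invr_ge0 ?exprn_ge0//.
      by rewrite ler_nat leq_subr.
    by rewrite lef_pV2 ?posrE ?exprn_gt0// ler_eXn2l ?ltr1n// leq_mul2r ab orbT.
  rewrite qR mulSn exprD invfM mulrCA ler_piMr ?invr_ge0 ?exprn_ge0//.
  by rewrite ler_pdivrMr ?exprn_gt0// mul1r ler_eXn2l ?ltr1n// leq_mul2l leqnSn orbT.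
Qed.

Section Tests.
Context (R : realType).
Implicit Types Y S G Z : nat -> bool.

Lemma uniq_pos (s : seq nat) : uniq s -> uniq (map pos s).
Proof. by move=> us; rewrite map_inj_uniq//; exact: pos_inj. Qed.

Lemma cyl_pos (s : seq nat) t : cyl (map pos s) t <-> {in s, forall z, branch t z}.
Proof.
split=> [h z zs|h v /mapP[z zs ->]]; first by apply: h; rewrite map_f.
exact: h.
Qed.

Lemma often_hitT Y S G (g : nat -> nat) (C : nat -> seq nat) :
  (forall i, g i < g i.+1) -> (forall i, G (g i)) ->
  (forall i, uniq (C i)) -> (forall i z, z \in C i -> g i <= z < g i.+1) ->
  (forall i Z, {in C i, forall z, Z z} -> hit Y S G Z (g i)) ->
  (forall K : nat, exists M, (K%:R <= \sum_(i < M) (2 ^+ size (C i) : R)^-1)%R) ->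
  often_hit R Y S G.
Proof.
move=> gS Gg uC Cg hC sC.
have := @ae_infinitely_often R (fun i => map pos (C i)).
case=> [i||K|N [mN N0 PN]]; first exact: uniq_pos.
- move=> i j v ij /mapP[z zi ->]; apply/negP => /mapP[z' zj /pos_inj zz'].
  subst z'; have /andP[_ h1] := Cg _ _ zi; have /andP[h2 _] := Cg _ _ zj.
  by have := incr_le gS ij; lia.
- by have [M hM] := sC K; exists M; under eq_bigr do rewrite size_map.
- exists N; split=> // t /= h; apply: PN => /= h'; apply: h => x.
  have [i [xi /cyl_pos Ci]] := h' x.+1; exists (g i); split.
    by apply: leq_trans xi _; exact: incr_ge.
  by split=> //; exact: hC.
Qed.

Lemma often_hitF Y S G (C : nat -> seq nat) :
  (forall i, uniq (C i)) ->
  (forall g Z, G g -> hit Y S G Z g -> exists i, {in C i, forall z, Z z}) ->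
  (forall M, (\sum_(i < M) (2 ^+ size (C i) : R)^-1 <= 2^-1)%R) ->
  ~ often_hit R Y S G.
Proof.
move=> uC hC sC h.
apply: (@not_ae_exists R (fun i => map pos (C i))).
- by move=> i; exact: uniq_pos.
- by move=> M; under eq_bigr do rewrite size_map.
- apply: ae_imp h => t /(_ 0)[g [_ [Gg /hC]]] /(_ Gg)[i Ci].
  by exists i; apply/cyl_pos.
Qed.

Lemma ae_shift (P : (nat -> bool) -> Prop) n :
  (\forall t \ae coin_measure R, P (branch t)) ->
  \forall t \ae coin_measure R, P (fun k => branch t (k + n)).
Proof.
pose f (v : vertex) := pos n ++ v.
have fI : injective f by move=> u v /eqP; rewrite eqseq_cat// => /andP[_ /eqP].
move=> /(ae_relabel fI); apply: ae_imp => t /=.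
rewrite (_ : branch (t \o f) = fun k => branch t (k + n))//.
by apply/funext => k; rewrite /branch /= /f /pos addnC nseqD.
Qed.

End Tests.

(** * The gaps of [Y] are eventually constant iff [ap Y] *)

Section NumAp.
Context (R : realType).
Variables (Y : nat -> bool) (n N r : nat).
Hypothesis YE : forall i, N <= i -> Y i = (i == r %[mod n.+1]).

Lemma num_add i : N <= i -> Y (i + n.+1) = Y i.
Proof. by move=> Ni; rewrite !YE ?modnDr//; lia. Qed.

Lemma num_dist i j : N <= i -> i < j -> Y i -> Y j -> i + n.+1 <= j.
Proof.
move=> Ni ij; rewrite !YE//; last by lia.
move=> /eqP <-; rewrite eqn_mod_dvd; last by lia.
have ji : 0 < j - i by lia.
by move=> /(dvdn_leq ji); lia.
Qed.

Lemma num_gapfree i z : N <= i -> z < i + n.+1 -> Y i -> gapfree Y i z.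
Proof.
move=> Ni zi Yi w iw wz Yw; have := num_dist Ni iw Yi Yw; lia.
Qed.

Lemma num_consec i : N <= i -> Y i -> consec Y i (i + n.+1).
Proof.
move=> Ni Yi; split=> //; split; first by rewrite num_add.
by split=> [|w iw wi]; [lia|apply: (num_gapfree Ni _ Yi iw (leqnn w))].
Qed.

Lemma num_infinitely : infinitely Y.
Proof.
move=> m; exists (r + (m + N).+1 * n.+1); split; first by nia.
by rewrite YE ?modnMDr //; [rewrite addnC modnMDl|nia].
Qed.

Lemma num_ap : ap R Y.
Proof.
split; first exact: num_infinitely; split=> [G iG GY|S S' G G' iG].
  have iG' : infinitely (fun x => (N <= x) && G x).
    move=> m; have [k [mk Gk]] := iG (maxn m N); exists k.
    by move: mk; rewrite gtn_max Gk andbT => /andP[-> /ltnW].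
  have [g [gS gE]] := enumerate iG'.
  have /all_and2[gN Gg] i : N <= g i /\ G (g i).
    by have /andP[] : (N <= g i) && G (g i) by apply/gE; exists i.
  apply: (@often_hitT R Y G G g (fun i => iota (g i) n.+1)) => //.
  - by move=> i; exact: iota_uniq.
  - move=> i z; rewrite mem_iota => /andP[-> zi]; apply: leq_trans zi _.
    exact: (num_dist (gN i) (gS i) (GY _ (Gg _)) (GY _ (Gg _))).
  - move=> i Z h z gz fz [s [Gs [sz fs]]]; apply: h.
    rewrite mem_iota gz/= ltnNge; apply/negP => zi.
    have sg : s <= g i.
      by rewrite leqNgt; apply/negP => gs; exact: (fz _ gs sz Gs).
    have := fs (g i + n.+1) _ zi; rewrite num_add ?GY// => h; apply: h => //.
    lia.
  - move=> K; exists (K * 2 ^ n.+1).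
    under eq_bigr do rewrite size_iota.
    rewrite sumr_const card_ord -[leRHS]mulr_natl natrM natrX -mulrA divff ?mulr1//.
move=> [SY [S'Y nS]] [GY [G'Y nG]] h.
have step T T' i : nexts Y T T' -> N <= i -> T i -> T' (i + n.+1).
  move=> [TY [_ nT]] Ni Ti; have [+ _] := nT _ _ (num_consec Ni (TY _ Ti)).
  exact.
pose P A := forall x, exists g, x < g /\ G g /\ hit Y S G A g.
apply: ae_imp (@ae_shift R P n.+1 h) => t ht x.
have [g [xg [Gg hg]]] := ht (maxn x N).
move: xg; rewrite gtn_max => /andP[xg Ng].
exists (g + n.+1); split; [lia|split].
  by apply: (step G) => //; exact: ltnW.
move=> z gz fz [s' [S's [sz fs]]].
have gs : g + n.+1 <= s'.
  rewrite leqNgt; apply/negP => sg; apply: (fs _ sg gz).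
  by rewrite num_add ?GY//; exact: ltnW.
rewrite (_ : z = z - n.+1 + n.+1); last by lia.
have Ys : Y (s' - n.+1).
  rewrite -num_add; last by lia.
  by rewrite subnK; [exact: S'Y|lia].
apply: hg; first by lia.
- move=> w gw wz Gw; apply: (fz (w + n.+1)); try lia.
  by apply: (step G) => //; lia.
- exists (s' - n.+1); split.
    have Ns : N <= s' - n.+1 by lia.
    have [_ h1] := nS _ _ (num_consec Ns Ys).
    by apply: h1; rewrite subnK; [exact: S's|lia].
  split; first by lia.
  move=> w sw wz Yw; apply: (fs (w + n.+1)); try lia.
  by rewrite num_add//; lia.
Qed.

End NumAp.

Section Blocks.
Variables (s : nat -> nat) (a : nat).
Hypothesis sS : forall j, s j + a <= s j.+1.

Definition blocks K k : seq nat := flatten [seq iota (s j) a | j <- iota K k].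

Lemma mem_blocks K k z :
  reflect (exists2 j, K <= j < K + k & s j <= z < s j + a) (z \in blocks K k).
Proof.
apply: (iffP flatten_mapP) => -[j].
  by rewrite !mem_iota => jK zj; exists j.
by move=> jK zj; exists j; rewrite mem_iota.
Qed.

Lemma size_blocks K k : size (blocks K k) = a * k.
Proof.
rewrite /blocks; elim: k K => [|k IH] K; first by rewrite muln0.
by rewrite /= size_cat size_iota IH mulnS.
Qed.

Lemma blocks_disjoint i j z : s i <= z < s i + a -> i < j -> z < s j.
Proof.
move=> zi; elim: j => // j IH; rewrite ltnS leq_eqVlt => /orP[/eqP <-|/IH h].
  by have := sS i; lia.
by have := sS j; lia.
Qed.

Lemma uniq_blocks K k : uniq (blocks K k).
Proof.
elim: k K => //= k IH K; rewrite /blocks/= cat_uniq iota_uniq IH andbT/=.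
apply/hasPn => z /mem_blocks[j jK zj]; rewrite mem_iota; apply/negP => zK.
have Kj : K < j by lia.
by have := blocks_disjoint zK Kj; lia.
Qed.
End Blocks.

Section ApNum.
Context (R : realType).
Variables (Y : nat -> bool) (y : nat -> nat).
Hypothesis yS : forall i, y i < y i.+1.
Hypothesis YE : forall x, Y x <-> exists i, x = y i.
Let d i := y i.+1 - y i.

Let Yy i : Y (y i). Proof. by apply/YE; exists i. Qed.

Let gapfree_y i z : z < y i.+1 -> gapfree Y (y i) z.
Proof.
move=> zi w iw wz /YE[j wj]; move: iw wz; rewrite {}wj (incr_ltE yS) => ij jz.
have : y j < y i.+1 by exact: leq_ltn_trans zi.
by rewrite (incr_ltE yS); lia.
Qed.

Let gapfree_le i z : gapfree Y (y i) z -> z < y i.+1.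
Proof.
move=> h; rewrite ltnNge; apply/negP => iz.
exact: h (yS i) iz (Yy _).
Qed.

Let img (h : nat -> nat) x : bool := `[< exists i, x = y (h i) >].

Let imgP h i : img h (y (h i)). Proof. by apply/asboolP; exists i. Qed.

Let img_sub h : sub (img h) Y.
Proof. by move=> x /asboolP[i ->]. Qed.

Let img_infinite h : (forall i, h i < h i.+1) -> infinitely (img h).
Proof.
move=> hS n; exists (y (h n.+1)); split; last exact: imgP.
exact: leq_trans (incr_ge hS n.+1) (incr_ge yS _).
Qed.

Let img_nexts h : nexts Y (img h) (img (fun i => (h i).+1)).
Proof.
split; first exact: img_sub; split; first exact: img_sub.
move=> u v /(consec_image yS YE)[i [-> ->]]; split=> /asboolP[j].
  by move=> /(incr_inj yS) ->; apply/asboolP; exists j.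
by move=> /(incr_inj yS) [->]; apply/asboolP; exists j.
Qed.

Lemma gaps_bounded :
  (forall G : nat -> bool, infinitely G -> sub G Y -> often_hit R Y G G) ->
  exists B, forall i, d i <= B.
Proof.
move=> h; apply: contrapT => nB.
have [|f [fS fd]] := @subsequence (fun i m => i.+2 <= d m).
  move=> i n; apply: contrapT => h1; apply: nB.
  exists (i.+2 + \sum_(j < n.+1) d j) => m.
  have [mn|nm] := leqP m n.
    by rewrite (bigD1 (Ordinal (mn : m < n.+1)))//=; lia.
  by rewrite leqNgt; apply/negP => h2; apply: h1; exists m; split=> //; lia.
apply: (@often_hitF R Y (img f) (img f) (fun i => iota (y (f i)) (d (f i)))).
- by move=> i; exact: iota_uniq.
- move=> _ Z /asboolP[i ->] hi; exists i => z.
  rewrite mem_iota => /andP[iz]; rewrite /d => zi.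
  have {}zi : z < y (f i).+1 by have := yS (f i); lia.
  have gf := gapfree_y zi.
  apply: hi => //; first by move=> w iw wz /img_sub; exact: gf.
  by exists (y (f i)); split; first exact: imgP.
- move=> M; apply: (@le_trans _ _ (2^-1 * (1 - (2 ^+ M)^-1))%R); last first.
    have : (0 <= ((2 : R) ^+ M)^-1)%R by rewrite invr_ge0 exprn_ge0.
    lra.
  elim: M => [|M IH]; first by rewrite big_ord0 expr0 invr1 subrr mulr0.
  rewrite big_ord_recr/= size_iota.
  apply: le_trans (lerD IH (_ : _ <= (2 ^+ M.+2)^-1)%R) _; last first.
    by rewrite !exprS !invfM; lra.
  by rewrite lef_pV2 ?posrE ?exprn_gt0// ler_eXn2l ?ltr1n.
- by apply: h; [exact: img_infinite|exact: img_sub].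
Qed.

Lemma gaps_nonincreasing B : (forall i, d i <= B) ->
  (forall S S' G G' : nat -> bool, infinitely G -> nexts Y S S' ->
    nexts Y G G' -> often_hit R Y S G -> often_hit R Y S' G') ->
  exists I, forall i, I < i -> d i.+1 <= d i.
Proof.
move=> dB H; suff /ninfinitely[I hI] : ~ infinitely (fun i => d i < d i.+1).
  by exists I => i /hI; lia.
move=> /(@pigeonhole _ d B.+1)[i _|a]; first exact: dB.
move=> /(@pigeonhole _ (fun i => d i.+1) B.+1)[i _|b hab]; first exact: dB.
have [|h [hS hd]] := @subsequence (fun _ i => (d i < d i.+1 /\ d i = a) /\ d i.+1 = b).
  by [].
have da j : d (h j) = a by have [[]] := hd j.
have db j : d (h j).+1 = b by have [] := hd j.
have ab : a < b by have [[]] := hd 0; rewrite da db.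
have a0 : 0 < a by rewrite -(da 0) /d subn_gt0.
have ya j : y (h j).+1 = y (h j) + a.
  by rewrite -(da j) /d subnKC// ltnW.
have yb j : y (h j).+2 = y (h j).+1 + b.
  by rewrite -(db j) /d subnKC// ltnW.
have [k [k0 ka kb]] := group_sizes R a0 ab.
pose K := fix K i := if i is j.+1 then K j + k j else 0.
have KS i : K i < K i.+1 by rewrite /= -addn1 leq_add2l k0.
have hKS i : h (K i) < h (K i.+1) by exact: incr_lt.
have yle i j : i <= j -> y (h i) <= y (h j).
  by move=> ij; apply: incr_le => //; exact: incr_le.
have s1 j : y (h j) + a <= y (h j.+1).
  by rewrite -ya; apply: incr_le.
have s2 j : y (h j).+1 + b <= y (h j.+1).+1.
  by rewrite -yb; apply: (incr_le yS); rewrite ltnS; exact: hS.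
have G1 := @img_infinite (fun i => h (K i)) hKS.
have := H _ _ _ _ G1 (img_nexts h) (img_nexts (fun i => h (K i))).
apply: contraPP => _; rewrite not_implyE; split.
- apply: (@often_hitT R Y _ _ (fun i => y (h (K i)))
    (fun i => blocks (fun j => y (h j)) a (K i) (k i))).
  + by move=> i; exact: (incr_lt yS (hKS i)).
  + by move=> i; apply/asboolP; exists i.
  + by move=> i; apply: uniq_blocks.
  + move=> i z /mem_blocks[j /andP[Kj jK] /andP[jz zj]].
    rewrite (leq_trans (yle _ _ Kj) jz)/=.
    by apply: leq_trans zj _; apply: leq_trans (s1 j) _; exact: yle.
  + move=> i Z hZ z gz fz [_ [/asboolP[j ->] [jz fj]]]; apply: hZ.
    apply/mem_blocks; exists j; last by rewrite jz -ya gapfree_le.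
    apply/andP; split.
      rewrite leqNgt; apply/negP => jK; apply: (fj (y (h (K i)))) => //.
      by apply: incr_lt => //; exact: incr_lt.
    rewrite ltnNge; apply/negP => Kj; apply: (fz (y (h (K i.+1)))).
    + exact: incr_lt.
    + by apply: leq_trans jz; exact: yle.
    + by apply/asboolP; exists i.+1.
  + move=> N; have [M hM] := ka N; exists M.
    by under eq_bigr do rewrite size_blocks.
- apply: (@often_hitF R Y _ _ 
    (fun i => blocks (fun j => y (h j).+1) b (K i) (k i))).
  + by move=> i; apply: uniq_blocks.
  + move=> _ Z /asboolP[i ->] hi; exists i => z /mem_blocks[j /andP[Kj jK] /andP[jz zj]].
    have fz : gapfree Y (y (h j).+1) z by apply: gapfree_y; rewrite yb.
    apply: hi.
    * by apply: leq_trans jz; apply: incr_le => //; rewrite ltnS; exact: incr_le.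
    * move=> w iw wz /asboolP[m wm]; move: iw wz; rewrite {}wm (incr_ltE yS) ltnS.
      rewrite (incr_ltE hS) (incr_ltE KS) => im mz.
      have Km := incr_le KS im.
      apply: (fz (y (h (K m)).+1)) => //.
      rewrite (incr_ltE yS) ltnS (incr_ltE hS); exact: leq_trans Km.
    * by exists (y (h j).+1); split; [apply/asboolP; exists j|].
  + by move=> M; under eq_bigr do rewrite size_blocks.
Qed.

End ApNum.

Lemma eventually_constant (d : nat -> nat) I : (forall i, I < i -> d i.+1 <= d i) ->
  exists J, forall i, J <= i -> d i = d J.
Proof.
have [v] := ubnP (d I.+1); elim: v I => // v IH I dv dI.
have [h|/existsNP[i /not_implyP[Ii di]]] :=
  pselect (forall i, I < i -> d i = d I.+1); first by exists I.+1.
have le_d j : I < j -> d j <= d I.+1.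
  elim: j => // j IHj; rewrite ltnS leq_eqVlt => /orP[/eqP ->//|Ij].
  exact: leq_trans (dI _ Ij) (IHj Ij).
case: i Ii di => // i Ii di; apply: (IH i) => [|j ij]; last by apply: dI; lia.
by have := le_d _ Ii; move: di dv; lia.
Qed.

Theorem apP (R : realType) Y : ap R Y <-> exists n, num Y n.
Proof.
split=> [[iY [H1 H2]]|[n [N [r YE]]]]; last exact: num_ap YE.
have [y [yS YE]] := enumerate iY.
have [B dB] := gaps_bounded yS YE H1.
have [I dI] := gaps_nonincreasing yS YE dB H2.
have [J dJ] := @eventually_constant (fun i => y i.+1 - y i) I dI.
set n := y J.+1 - y J in dJ.
have n0 : 0 < n by rewrite subn_gt0.
have yk k : y (J + k) = y J + k * n.
  elim: k => [|k IH]; first by rewrite addn0 mul0n addn0.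
  have := dJ (J + k) (leq_addr _ _); have := yS (J + k).
  by rewrite addnS mulSn IH; lia.
exists n.-1, (y J), (y J) => i Ji; rewrite prednK// eqn_mod_dvd//.
apply/idP/idP => [/YE[j ij]|/dvdnP[k ik]].
  have Jj : J <= j by move: Ji; rewrite ij leqNgt (incr_ltE yS) -leqNgt.
  by rewrite ij -(subnKC Jj) yk addKn dvdn_mull.
by apply/YE; exists (J + k); rewrite yk -ik subnKC.
Qed.

(** * Order and finite relations *)

Definition wle (A B : nat -> bool) : Prop :=
  exists N, forall x x', N < x -> consec B x x' -> exists y, x <= y /\ y < x' /\ A y.

Definition pairs (U V : nat -> bool) m n : Prop :=
  infinitely (fun u =>
    U u /\ consec V u (u + m.+1) /\ consec V (u + m.+1) (u + m.+1 + n.+1)).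

Definition coded_pair (R : realType) (U V A B : nat -> bool) : Prop :=
  exists A' B', ap R A' /\ ap R B' /\ wle A A' /\ wle A' A /\ wle B B' /\ wle B' B /\
  forall n, exists u, n < u /\ U u /\ exists v w,
    consec V u v /\ consec V v w /\ consec A' u v /\ consec B' v w.

Lemma consec_functional Y x y z : consec Y x y -> consec Y x z -> y = z.
Proof.
move=> [_ [Yy [xy hy]]] [_ [Yz [xz hz]]].
case: (ltngtP y z) => // [yz|zy]; first by case: (hz y xy yz).
by case: (hy z xz zy).
Qed.

Lemma wleP A B m n : num A m -> num B n -> wle A B <-> m <= n.
Proof.
move=> [N [r AE]] [N' [r' BE]]; split=> [[M hM]|mn].
  rewrite leqNgt; apply/negP => nm.
  have [x [Mx Bx]] := num_infinitely BE (M + N + N').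
  have win k : exists y, x + k * n.+1 <= y /\ y < x + k * n.+1 + n.+1 /\ A y.
    apply: (hM (x + k * n.+1)); first by lia.
    apply: (num_consec BE); first by lia.
    rewrite BE; last by lia.
    rewrite [x + _]addnC modnMDl -BE//; lia.
  have [y0 [xy0 [y0x Ay0]]] := win 0.
  have h k : exists y, [/\ x + k * n.+1 <= y, y < x + k * n.+1 + n.+1, A y & y0 + k * m.+1 <= y].
    elim: k => [|k [y [y1 y2 Ay y3]]]; first by exists y0; split=> //; lia.
    have [z [z1 [z2 Az]]] := win k.+1; exists z; split=> //.
    have := @num_dist _ _ _ _ AE y z; move: y1 y2 y3 z1; rewrite !mulSn => *.
    by have : y + m.+1 <= z by [apply: (num_dist AE) => //; lia]; lia.
  by have [y [_ y2 _ y3]] := h n.+1; nia.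
exists (N + N') => x x' Nx cx.
have xx' : x' = x + n.+1.
  apply: (consec_functional cx (num_consec BE _ _)); first by lia.
  by have [] := cx.
exists (x + (m * x + r) %% m.+1); split; first exact: leq_addr.
split; first by rewrite xx' ltn_add2l (leq_trans (ltn_pmod _ _)).
rewrite AE; last by lia.
by rewrite modnDmr addnA -mulSn mulnC modnMDl.
Qed.

Lemma num_exists n r : num (fun i => i == r %[mod n.+1]) n.
Proof. by exists 0, r. Qed.

Lemma coded_pairP (R : realType) U V A B m n : num A m -> num B n ->
  coded_pair R U V A B <-> pairs U V m n.
Proof.
move=> hA hB; split=> [[A' [B' [/apP[m' hA'] [/apP[n' hB'] [AA' [A'A [BB' [B'B H]]]]]]]]|H].
  have mm : m' = m.
    by apply/eqP; rewrite eqn_leq; apply/andP; split; [apply/(wleP hA' hA)|apply/(wleP hA hA')].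
  have nn : n' = n.
    by apply/eqP; rewrite eqn_leq; apply/andP; split; [apply/(wleP hB' hB)|apply/(wleP hB hB')].
  subst m' n'; have [N [r AE]] := hA'; have [N' [r' BE]] := hB'.
  move=> k; have [u [ku [Uu [v [w [Vuv [Vvw [Auv Bvw]]]]]]]] := H (k + N + N').
  have uv : v = u + m.+1.
    apply: (consec_functional Auv (num_consec AE _ _)); first by lia.
    by have [] := Auv.
  have vw : w = v + n.+1.
    apply: (consec_functional Bvw (num_consec BE _ _)); first by lia.
    by have [] := Bvw.
  by exists u; rewrite -uv -vw; split; first by lia.
have [|c hc] := pigeonhole (f := fun u => u %% (m.+1 * n.+1)) (B := m.+1 * n.+1) H.
  by move=> i _; rewrite ltn_mod muln_gt0.
have hA' := num_exists m c; have hB' := num_exists n (c + m.+1).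
exists (fun i => i == c %[mod m.+1]), (fun i => i == c + m.+1 %[mod n.+1]).
split; first by apply/apP; exists m.
split; first by apply/apP; exists n.
do 2![split; first by apply/wleP; eauto].
do 2![split; first by apply/wleP; eauto].
move=> k; have [u [ku [[Uu [Vu Vv]] uc]]] := hc k.
exists u; split=> //; split=> //; exists (u + m.+1), (u + m.+1 + n.+1).
do 2!split=> //; split.
  apply: (@num_consec _ _ 0 c) => //; rewrite -uc modn_dvdm//.
  exact: dvdn_mulr.
apply: (@num_consec _ _ 0 (c + m.+1)) => //; rewrite eqn_modDr -uc modn_dvdm//.
exact: dvdn_mull.
Qed.

Lemma pairs_realize N (f : nat -> nat) :
  exists U V, forall m n, pairs U V m n <-> m <= N /\ n = f m.
Proof.
pose gap i := if odd i then f (i./2 %% N.+1) else i./2 %% N.+1.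
pose z := fix z i := if i is j.+1 then z j + (gap j).+1 else 0.
have zE i : z i.+1 = z i + (gap i).+1 by [].
have zS i : z i < z i.+1 by rewrite zE addnS ltnS leq_addr.
pose V x : bool := `[< exists i, x = z i >].
have VE x : V x <-> exists i, x = z i by split=> /asboolP.
pose U x : bool := `[< exists k, x = z k.*2 >].
have gap0 k : gap k.*2 = k %% N.+1 by rewrite /gap odd_double doubleK.
have gap1 k : gap k.*2.+1 = f (k %% N.+1).
  by rewrite /gap /= odd_double /= uphalf_double.
exists U, V => m n; split=> [h|[mN ->] b].
  have [u [_ [/asboolP[k ->] [/(consec_image zS VE)[i [ki vi]]
    /(consec_image zS VE)[j [vj wj]]]]]] := h 0.
  have {ki} ki := incr_inj zS ki; subst i.
  have mk : m = k %% N.+1 by move: vi; rewrite zE gap0; lia.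
  move: vj; rewrite vi => /(incr_inj zS) ij; subst j.
  have nk : n = f (k %% N.+1) by move: wj; rewrite vi [RHS]zE gap1; lia.
  by rewrite nk -mk; split=> //; rewrite mk -ltnS ltn_mod.
pose k := b.+1 * N.+1 + m.
have km : k %% N.+1 = m by rewrite modnMDl modn_small.
exists (z k.*2); split; first by apply: leq_trans (incr_ge zS _); rewrite /k; lia.
split; first by apply/asboolP; exists k.
have z1 : z k.*2 + m.+1 = z k.*2.+1 by rewrite zE gap0 km.
have z2 : z k.*2.+1 + (f m).+1 = z k.*2.+2 by rewrite [RHS]zE gap1 km.
split; apply/(consec_image zS VE); first by exists k.*2; rewrite z1.
by exists k.*2.+1; rewrite z1 z2.
Qed.

(** * Arithmetical definability *)

(* The number variable [i] is the set variable [nv i]; the set variables 8 and 9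
   hold the code of a relation and the smaller ones are auxiliary. *)
Definition nv (i : nat) : nat := i.+4.+4.+2.

Definition Linfinitely A := LAll1 0 (LEx1 1 (LAnd (LLt 0 1) (LIn 1 A))).
Definition Lsub A B := LAll1 0 (LImp (LIn 0 A) (LIn 0 B)).
Definition Lgapfree A x z :=
  LAll1 9 (LImp (LLt x 9) (LImp (LLe 9 z) (LNot (LIn 9 A)))).
Definition Lblock Y S z :=
  LEx1 8 (LAnd (LIn 8 S) (LAnd (LLe 8 z) (Lgapfree Y 8 z))).
Definition Lhit Y S G Z g :=
  LAll1 7 (LImp (LLe g 7) (LImp (Lgapfree G g 7) (LImp (Lblock Y S 7) (LIn 7 Z)))).
Definition Loften_hit Y S G :=
  LAe 0 (LAll1 0 (LEx1 1 (LAnd (LLt 0 1) (LAnd (LIn 1 G) (Lhit Y S G 0 1))))).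
Definition Lconsec Y x y :=
  LAnd (LIn x Y) (LAnd (LIn y Y) (LAnd (LLt x y)
    (LAll1 9 (LImp (LLt x 9) (LImp (LLt 9 y) (LNot (LIn 9 Y))))))).
Definition Lnexts Y S S' :=
  LAnd (Lsub S Y) (LAnd (Lsub S' Y)
    (LAll1 0 (LAll1 1 (LImp (Lconsec Y 0 1)
      (LAnd (LImp (LIn 0 S) (LIn 1 S')) (LImp (LIn 1 S') (LIn 0 S))))))).
Definition Lap Y :=
  LAnd (Linfinitely Y) (LAnd
    (LAll2 1 (LImp (Linfinitely 1) (LImp (Lsub 1 Y) (Loften_hit Y 1 1))))
    (LAll2 1 (LAll2 2 (LAll2 3 (LAll2 4
      (LImp (Linfinitely 3) (LImp (Lnexts Y 1 2) (LImp (Lnexts Y 3 4)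
        (LImp (Loften_hit Y 1 3) (Loften_hit Y 2 4)))))))))).
Definition Lwle A B :=
  LEx1 0 (LAll1 1 (LAll1 2 (LImp (LLt 0 1) (LImp (Lconsec B 1 2)
    (LEx1 3 (LAnd (LLe 1 3) (LAnd (LLt 3 2) (LIn 3 A)))))))).
Definition Lcoded_pair A B :=
  LEx2 5 (LEx2 6 (LAnd (Lap 5) (LAnd (Lap 6)
    (LAnd (Lwle A 5) (LAnd (Lwle 5 A) (LAnd (Lwle B 6) (LAnd (Lwle 6 B)
      (LAll1 0 (LEx1 1 (LAnd (LLt 0 1) (LAnd (LIn 1 8) (LEx1 2 (LEx1 3
        (LAnd (Lconsec 9 1 2) (LAnd (Lconsec 9 2 3)
          (LAnd (Lconsec 5 1 2) (Lconsec 6 2 3))))))))))))))))).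

Section Definability.
Context (R : realType).

Lemma lsat_wle e E i j : lsat R e E (Lwle (nv i) (nv j)) = wle (E (nv i)) (E (nv j)).
Proof. by []. Qed.

Lemma lsat_coded_pair e E i j : lsat R e E (Lcoded_pair (nv i) (nv j)) =
  coded_pair R (E 8) (E 9) (E (nv i)) (E (nv j)).
Proof. by []. Qed.

Implicit Types (P Q : (nat -> nat) -> (nat -> bool) -> (nat -> bool) -> Prop).

(* Arithmetical definability: the numbers [rho i], [i < k], are given by sets
   [E (nv i)] of eventual period [(rho i).+1]. *)
Definition ndef k P : Prop :=
  exists phi, forall e E rho, (forall i, i < k -> num (E (nv i)) (rho i)) ->
    lsat R e E phi <-> P rho (E 8) (E 9).

Lemma ndef_iff k P Q : (forall rho U V, P rho U V <-> Q rho U V) ->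
  ndef k P -> ndef k Q.
Proof.
by move=> PQ [phi h]; exists phi => e E rho hE; rewrite (h e E rho hE) PQ.
Qed.

Lemma ndef_not k P : ndef k P -> ndef k (fun rho U V => ~ P rho U V).
Proof.
by move=> [phi h]; exists (LNot phi) => e E rho hE; rewrite /= (h e E rho hE).
Qed.

Lemma ndef_and k P Q : ndef k P -> ndef k Q ->
  ndef k (fun rho U V => P rho U V /\ Q rho U V).
Proof.
move=> [phi h] [psi h']; exists (LAnd phi psi) => e E rho hE.
by rewrite /= (h e E rho hE) (h' e E rho hE).
Qed.

Lemma ndef_imp k P Q : ndef k P -> ndef k Q ->
  ndef k (fun rho U V => P rho U V -> Q rho U V).
Proof.
move=> [phi h] [psi h']; exists (LImp phi psi) => e E rho hE.
by rewrite /= (h e E rho hE) (h' e E rho hE).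
Qed.

Lemma ndef_or k P Q : ndef k P -> ndef k Q ->
  ndef k (fun rho U V => P rho U V \/ Q rho U V).
Proof.
move=> dP dQ; apply: ndef_iff (ndef_imp (ndef_not dP) dQ) => rho U V.
split=> [h|[p /(_ p)//|//]].
by case: (pselect (P rho U V)) => p; [left|right; exact: h].
Qed.

Lemma ndef_ex k (Q : (nat -> nat) -> (nat -> bool) -> (nat -> bool) -> nat -> Prop) :
  (forall rho n, Q (update rho k n) = Q rho) ->
  ndef k.+1 (fun rho U V => Q rho U V (rho k)) ->
  ndef k (fun rho U V => exists n, Q rho U V n).
Proof.
move=> Qk [phi h]; exists (LEx2 (nv k) (LAnd (Lap (nv k)) phi)) => e E rho hE.
have hE' A n : num A n -> forall i, i < k.+1 ->
    num (update E (nv k) A (nv i)) (update rho k n i).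
  move=> An i; rewrite /update ltnS /nv !eqSS; case: eqP => // /eqP ik ik'.
  by apply: hE; rewrite ltn_neqAle ik.
split=> [[A [hA]]|[n hn]].
  have {hA} : ap R (update E (nv k) A (nv k)) by [].
  rewrite update_same => /apP[n An] /(h _ _ _ (hE' _ _ An)).
  by rewrite Qk update_same => hn; exists n.
exists (fun i => i == 0 %[mod n.+1]); split.
  change (ap R (update E (nv k) (fun i => i == 0 %[mod n.+1]) (nv k))).
  by rewrite update_same; apply/apP; exists n; exact: num_exists.
apply/(h _ _ _ (hE' _ _ (num_exists n 0))).
by rewrite Qk update_same.
Qed.

Lemma ndef_all k (Q : (nat -> nat) -> (nat -> bool) -> (nat -> bool) -> nat -> Prop) :
  (forall rho n, Q (update rho k n) = Q rho) ->
  ndef k.+1 (fun rho U V => Q rho U V (rho k)) ->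
  ndef k (fun rho U V => forall n, Q rho U V n).
Proof.
move=> Qk dQ.
apply: ndef_iff (ndef_not (@ndef_ex k (fun rho U V n => ~ Q rho U V n) _ _)).
- move=> rho U V; split=> [h n|h [n]]; last exact.
  by apply: contrapT => nQ; apply: h; exists n.
- by move=> rho n; rewrite Qk.
- exact: ndef_not.
Qed.

Lemma ndef_ex_relation k P : ndef k P ->
  ndef k (fun rho _ _ => exists U V, P rho U V).
Proof.
move=> [phi h]; exists (LEx2 8 (LEx2 9 phi)) => e E rho hE.
have hE' U V : lsat R e (update (update E 8 U) 9 V) phi <-> P rho U V.
  by rewrite (h e _ rho).
by split=> -[U [V /hE' hUV]]; exists U, V.
Qed.

Lemma ndef_le k i j : i < k -> j < k -> ndef k (fun rho _ _ => rho i <= rho j).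
Proof.
move=> ik jk; exists (Lwle (nv i) (nv j)) => e E rho hE.
by rewrite lsat_wle; apply: wleP; exact: hE.
Qed.

Lemma ndef_pairs k i j : i < k -> j < k ->
  ndef k (fun rho U V => pairs U V (rho i) (rho j)).
Proof.
move=> ik jk; exists (Lcoded_pair (nv i) (nv j)) => e E rho hE.
by rewrite lsat_coded_pair; apply: coded_pairP; exact: hE.
Qed.

Lemma ndef_lt k i j : i < k -> j < k -> ndef k (fun rho _ _ => rho i < rho j).
Proof.
move=> ik jk; apply: ndef_iff (ndef_not (ndef_le jk ik)) => rho U V.
by rewrite ltnNge; split=> /negP.
Qed.

Lemma ndef_eq k i j : i < k -> j < k -> ndef k (fun rho _ _ => rho i = rho j).
Proof.
move=> ik jk; apply: ndef_iff (ndef_and (ndef_le ik jk) (ndef_le jk ik)) => rho U V.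
by split=> [[h1 h2]|->//]; apply/eqP; rewrite eqn_leq h1.
Qed.

Lemma update_lt (rho : nat -> nat) k n i : i < k -> update rho k n i = rho i.
Proof. by rewrite /update; case: eqP => // ->; rewrite ltnn. Qed.

Lemma map_update_lt (rho : nat -> nat) k n vs : all (fun i => i < k) vs ->
  map (update rho k n) vs = map rho vs.
Proof. by move=> /allP h; apply/eq_in_map => i /h; exact: update_lt. Qed.

Lemma ndef_zero k i : i < k -> ndef k (fun rho _ _ => rho i = 0).
Proof.
move=> ik; apply: (@ndef_iff k (fun rho _ _ => forall n, rho i <= n)).
  move=> rho U V; split=> [/(_ 0)|->//].
  by rewrite leqn0 => /eqP.
apply: (@ndef_all k (fun rho _ _ n => rho i <= n)).
  by move=> rho n; rewrite update_lt.
by apply: ndef_le; lia.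
Qed.

Lemma ndef_succ k i j : i < k -> j < k ->
  ndef k (fun rho _ _ => rho j = (rho i).+1).
Proof.
move=> ik jk; apply: (@ndef_iff k
  (fun rho _ _ => rho i < rho j /\ forall n, rho i < n -> rho j <= n)).
  move=> rho U V; split=> [[h1 /(_ (rho i).+1 (ltnSn _)) h2]|-> //].
  by apply/eqP; rewrite eqn_leq h2.
apply: ndef_and; first exact: ndef_lt.
apply: (@ndef_all k (fun rho _ _ n => rho i < n -> rho j <= n)).
  by move=> rho n; rewrite !update_lt.
by apply: ndef_imp; [apply: ndef_lt|apply: ndef_le]; lia.
Qed.

End Definability.

(** * Graphs of recursive functions *)

Lemma recfun_nested_ind (P : recfun -> Prop) :
  P Zero -> P Succ -> (forall i, P (Proj i)) ->
  (forall f gs, P f -> (forall g, List.In g gs -> P g) -> P (Comp f gs)) ->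
  (forall f g, P f -> P g -> P (PrimRec f g)) -> (forall f, P f -> P (Mu f)) ->
  forall f, P f.
Proof.
move=> p0 pS pP pC pR pM; fix IH 1 => -[||i|f gs|f g|f]; [by []|by []|exact: pP|..].
- apply: pC; first exact: IH.
  elim: gs => [|g gs IHgs] h /= => [[]|[<-|/IHgs//]]; exact: IH.
- by apply: pR; exact: IH.
- by apply: pM; exact: IH.
Qed.

Lemma computes_ZeroE xs y : computes Zero xs y <-> y = 0.
Proof. by split=> [h|->]; [inversion h|exact: computes_zero]. Qed.

Lemma computes_SuccE xs y : computes Succ xs y <-> y = (nth 0 xs 0).+1.
Proof. by split=> [h|->]; [inversion h|exact: computes_succ]. Qed.

Lemma computes_ProjE i xs y : computes (Proj i) xs y <-> y = nth 0 xs i.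
Proof. by split=> [h|->]; [inversion h|exact: computes_proj]. Qed.

Lemma computes_CompE f gs xs z : computes (Comp f gs) xs z <->
  exists ys, [/\ size ys = size gs,
    forall i, i < size gs -> computes (nth Zero gs i) xs (nth 0 ys i) &
    computes f ys z].
Proof.
split=> [h|[ys [sz hgs hf]]]; last exact: computes_comp sz hgs hf.
by inversion h as [| | |? ? ? ys' ? sz' hgs hf| | |]; subst; exists ys'.
Qed.

Lemma computes_PrimRec_nil f g y : ~ computes (PrimRec f g) [::] y.
Proof. by move=> h; inversion h. Qed.

Lemma computes_PrimRec_cons f g n xs y : computes (PrimRec f g) (n :: xs) y <->
  (n = 0 /\ computes f xs y) \/
  exists m, n = m.+1 /\ exists r,
    computes (PrimRec f g) (m :: xs) r /\ computes g (m :: r :: xs) y.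
Proof.
split=> [h|[[-> h]|[m [-> [r [h1 h2]]]]]].
- inversion h as [| | | |? ? ? ? hf|? ? m ? r ? hr hg|]; subst; [by left|right].
  by exists m; split=> //; exists r.
- exact: computes_primrec0.
- exact: computes_primrecS h1 h2.
Qed.

(* A finite relation all of whose pairs are justified certifies the recursion. *)
Lemma computes_PrimRecE f g n xs y : computes (PrimRec f g) (n :: xs) y <->
  exists U V, pairs U V n y /\ forall i v, pairs U V i v ->
    (i = 0 /\ computes f xs v) \/
    exists m, i = m.+1 /\ exists r, pairs U V m r /\ computes g (m :: r :: xs) v.
Proof.
split=> [h|[U [V [UVn H]]]].
  have [v vP] : exists v : nat -> nat, forall i, i <= n ->
      computes (PrimRec f g) (i :: xs) (v i).
    elim: n y h => [|n IH] y h; first by exists (fun=> y) => -[].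
    move/computes_PrimRec_cons: (h) => [[//]|[m [[<-] [r [hr _]]]]].
    have [v vP] := IH _ hr; exists (fun i => if i == n.+1 then y else v i) => i.
    by rewrite leq_eqVlt; case: eqP => [->|_] //=; rewrite ltnS; exact: vP.
  have [U [V UV]] := pairs_realize n v; exists U, V; split.
    by apply/UV; split=> //; exact: computes_functional h (vP _ (leqnn _)).
  move=> i _ /UV[ni ->].
  move/computes_PrimRec_cons: (vP _ ni) => [h0|[m [im [r [hr hg]]]]]; first by left.
  right; exists m; split=> //; exists r; split=> //; apply/UV; subst i.
  by split; [exact: ltnW|apply: computes_functional hr (vP _ _); exact: ltnW].
elim: n y UVn => [|n IH] y /H; rewrite computes_PrimRec_cons.
  by move=> [h|[m []//]]; left.
move=> [[]//|[m [[<-] [r [/IH hr hg]]]]]; right.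
by exists n; split=> //; exists r.
Qed.

Lemma computes_MuE f xs n : computes (Mu f) xs n <->
  (exists z, z = 0 /\ computes f (n :: xs) z) /\
  forall m, m < n -> exists v, exists w, w = v.+1 /\ computes f (m :: xs) w.
Proof.
split=> [h|[[_ [-> h0]] hlt]].
  inversion h as [| | | | | |? ? ? ys hlt hn]; subst.
  by split=> [|m /hlt hm]; [exists 0|exists (ys m), (ys m).+1].
have [ys hys] : exists ys : nat -> nat, forall m, m < n -> computes f (m :: xs) (ys m).+1.
  have ex m : exists v, m < n -> computes f (m :: xs) v.+1.
    case: (ltnP m n) => [/hlt[v [_ [-> hv]]]|_]; last by exists 0.
    by exists v.
  by have [ys hys] := boolp.choice ex; exists ys.
exact: computes_mu hys h0.
Qed.

Section Graph.
Context (R : realType).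

Definition graph_ndef f := forall k vs y, all (fun i => i < k) vs -> y < k ->
  ndef R k (fun rho _ _ => computes f (map rho vs) (rho y)).

Lemma ndef_comp f gs k vs zs y : graph_ndef f ->
  (forall g, List.In g gs -> graph_ndef g) ->
  all (fun i => i < k) vs -> all (fun i => i < k) zs -> y < k ->
  ndef R k (fun rho _ _ => exists ys, [/\ size ys = size gs,
    forall i, i < size gs -> computes (nth Zero gs i) (map rho vs) (nth 0 ys i) &
    computes f (map rho zs ++ ys) (rho y)]).
Proof.
move=> df; elim: gs k vs zs y => [|g gs IH] k vs zs y dgs vk zk yk.
  apply: ndef_iff (df k zs y zk yk) => rho U V; split=> [h|[ys [sz _]]].
    by exists [::]; rewrite cats0.
  by rewrite (size0nil sz) cats0.
have up s : all (fun i => i < k) s -> all (fun i => i < k.+1) s.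
  by apply: sub_all => i ik; exact: ltnW.
pose Q (rho : nat -> nat) (U V : nat -> bool) n := computes g (map rho vs) n /\
  exists ys, [/\ size ys = size gs,
    forall i, i < size gs -> computes (nth Zero gs i) (map rho vs) (nth 0 ys i) &
    computes f (map rho zs ++ n :: ys) (rho y)].
apply: (@ndef_iff R k (fun rho U V => exists n, Q rho U V n)).
  move=> rho U V; split=> [[n [hn [ys [sz hys hf]]]]|[[|n ys] [//= [sz] hys hf]]].
    by exists (n :: ys); split=> /= [|[|i]|]; rewrite ?sz//; exact: hys.
  exists n; split; first exact: (hys 0).
  by exists ys; split=> // i igs; exact: (hys i.+1).
apply: (@ndef_ex R k Q) => [rho n|].
  by rewrite /Q !map_update_lt// update_lt.
apply: ndef_and.
  by apply: dgs; [left|exact: up|].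
have := IH k.+1 vs (rcons zs k) y.
rewrite all_rcons ltnSn/=.
move=> /(_ (fun g gI => dgs g (or_intror gI)) (up _ vk) (up _ zk) (ltnW yk)).
apply: ndef_iff => rho U V; 
by split=> -[ys]; [rewrite map_rcons cat_rcons|]; exists ys; rewrite ?map_rcons ?cat_rcons.
Qed.

Lemma computes_ndef f : graph_ndef f.
Proof.
elim/recfun_nested_ind: f => [||i|f gs df dgs|f g df dg|f df] k vs y vk yk.
- by apply: ndef_iff (ndef_zero R yk) => rho U V; rewrite computes_ZeroE.
- case: vs vk => [_|x vs /= /andP[xk _]].
    pose Q (rho : nat -> nat) (U V : nat -> bool) n := n = 0 /\ rho y = n.+1.
    apply: (@ndef_iff R k (fun rho U V => exists n, Q rho U V n)).
      by move=> rho U V; rewrite computes_SuccE; split=> [[n [-> ->]]|h]; [|exists 0].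
    apply: ndef_ex => [rho n|]; first by rewrite /Q update_lt.
    by apply: ndef_and; [apply: ndef_zero|apply: ndef_succ; lia].
  by apply: ndef_iff (ndef_succ R xk yk) => rho U V; rewrite computes_SuccE.
- have [ivs|vsi] := ltnP i (size vs).
    have xk : nth 0 vs i < k by move/allP: vk; apply; exact: mem_nth.
    apply: ndef_iff (ndef_eq R yk xk) => rho U V.
    by rewrite computes_ProjE (nth_map 0).
  apply: ndef_iff (ndef_zero R yk) => rho U V.
  by rewrite computes_ProjE nth_default// size_map.
- apply: ndef_iff (ndef_comp (zs := [::]) df dgs vk isT yk) => rho U V.
  by rewrite computes_CompE.
- case: vs vk => [_|x vs /= /andP[xk vk]].
    have := ndef_and (ndef_zero R yk) (ndef_not (ndef_zero R yk)).
    apply: ndef_iff => rho U V; split=> [[]//|].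
    by move/computes_PrimRec_nil.
  have up j s : all (fun i => i < k) s -> all (fun i => i < k + j) s.
    by apply: sub_all => i ik; apply: leq_trans ik _; exact: leq_addr.
  have e2 : k.+2 = k + 2 by lia.
  have e4 : k.+4 = k + 4 by lia.
  pose Q3 (rho : nat -> nat) (U V : nat -> bool) (i v m r : nat) :=
    pairs U V m r /\ computes g (m :: r :: map rho vs) v.
  pose Q2 (rho : nat -> nat) (U V : nat -> bool) (i v m : nat) :=
    i = m.+1 /\ exists r, Q3 rho U V i v m r.
  pose Q1 (rho : nat -> nat) (U V : nat -> bool) (i v : nat) := pairs U V i v ->
    (i = 0 /\ computes f (map rho vs) v) \/ exists m, Q2 rho U V i v m.
  pose Q0 (rho : nat -> nat) (U V : nat -> bool) (i : nat) := forall v, Q1 rho U V i v.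
  apply: (@ndef_iff R k (fun rho _ _ => exists U V,
      pairs U V (rho x) (rho y) /\ forall i, Q0 rho U V i)).
    by move=> rho U V; rewrite computes_PrimRecE.
  apply: ndef_ex_relation; apply: ndef_and; first exact: ndef_pairs.
  have mu (rho : nat -> nat) j n : k <= j -> map (update rho j n) vs = map rho vs.
    by move=> kj; apply: map_update_lt; rewrite -(subnKC kj); exact: up.
  apply: ndef_all => [rho n|].
    by rewrite /Q0 /Q1 /Q2 /Q3 mu.
  apply: (@ndef_all R k.+1 (fun rho U V v => Q1 rho U V (rho k) v)) => [rho n|].
    by rewrite /Q1 /Q2 /Q3 mu ?update_lt//; lia.
  apply: ndef_imp; first by apply: ndef_pairs; lia.
  apply: ndef_or.
    apply: ndef_and; first by apply: ndef_zero; lia.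
    by apply: df; [rewrite e2; exact: up|lia].
  apply: (@ndef_ex R k.+2 (fun rho U V m => Q2 rho U V (rho k) (rho k.+1) m)) => [rho n|].
    by rewrite /Q2 /Q3 mu ?update_lt//; lia.
  apply: ndef_and; first by apply: ndef_succ; lia.
  apply: (@ndef_ex R k.+3 (fun rho U V r =>
    Q3 rho U V (rho k) (rho k.+1) (rho k.+2) r)) => [rho n|].
    by rewrite /Q3 mu ?update_lt//; lia.
  apply: ndef_and; first by apply: ndef_pairs; lia.
  apply: (dg k.+4 [:: k.+2, k.+3 & vs] k.+1) => /=; last by lia.
  by rewrite e4 up// !andbT; lia.
- have up j s : all (fun i => i < k) s -> all (fun i => i < k + j) s.
    by apply: sub_all => i ik; apply: leq_trans ik _; exact: leq_addr.
  have mu (rho : nat -> nat) j n : k <= j -> map (update rho j n) vs = map rho vs.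
    by move=> kj; apply: map_update_lt; rewrite -(subnKC kj); exact: up.
  pose P2 (rho : nat -> nat) (U V : nat -> bool) m v w :=
    w = v.+1 /\ computes f (m :: map rho vs) w.
  pose P1 (rho : nat -> nat) (U V : nat -> bool) m v := exists w, P2 rho U V m v w.
  pose P0 (rho : nat -> nat) (U V : nat -> bool) m :=
    m < rho y -> exists v, P1 rho U V m v.
  pose Q (rho : nat -> nat) (U V : nat -> bool) z :=
    z = 0 /\ computes f (rho y :: map rho vs) z.
  apply: (@ndef_iff R k (fun rho U V =>
      (exists z, Q rho U V z) /\ forall m, P0 rho U V m)).
    by move=> rho U V; rewrite computes_MuE.
  apply: ndef_and.
    apply: ndef_ex => [rho n|].
      by rewrite /Q map_update_lt// update_lt.
    apply: ndef_and; first exact: ndef_zero.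
    apply: (df k.+1 (y :: vs) k) => //=.
    by have := up 1 vs vk; rewrite addn1 => ->; lia.
  apply: ndef_all => [rho n|].
    by rewrite /P0 /P1 /P2 map_update_lt// update_lt.
  apply: ndef_imp; first by apply: ndef_lt; lia.
  apply: (@ndef_ex R k.+1 (fun rho U V v => P1 rho U V (rho k) v)) => [rho n|].
    by rewrite /P1 /P2 mu ?update_lt//; lia.
  apply: (@ndef_ex R k.+2 (fun rho U V w => P2 rho U V (rho k) (rho k.+1) w)) => [rho n|].
    by rewrite /P2 mu ?update_lt//; lia.
  apply: ndef_and; first by apply: ndef_succ; lia.
  apply: (df k.+3 (k :: vs) k.+2) => //=.
  by rewrite (_ : k.+3 = k + 3) ?up//; [rewrite andbT|]; lia.
Qed.

End Graph.

(** * Diagonalization *)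

(* [tr] shifts set variables by one. *)
Definition nw i := (nv i).+1.

Section Closing.
Context (R : realType).

Lemma free1_foldr_LAll1 xs phi z : z \in free1 (tr (foldr LAll1 phi xs)) ->
  z \in free1 (tr phi) /\ forall x, x \in xs -> z != x.+3.
Proof.
elim: xs => [|x xs IH] //; set psi := foldr LAll1 phi xs in IH *.
change (z \in [seq y <- x.+3 :: free1 (tr psi) | y != x.+3] ->
  z \in free1 (tr phi) /\ forall y, y \in x :: xs -> z != y.+3).
rewrite mem_filter inE => /andP[zx]; rewrite (negPf zx)/= => /IH[h1 h2]; split=> // y.
by rewrite inE => /predU1P[->//|]; exact: h2.
Qed.

Lemma free2_foldr_Forall2 Xs psi Z : Z \in free2 (foldr Forall2 psi Xs) ->
  Z \in free2 psi /\ Z \notin Xs.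
Proof.
elim: Xs => [|X Xs IH] //=; rewrite mem_filter => /andP[ZX] /IH[h1 h2].
by rewrite inE negb_or ZX h2.
Qed.

Lemma free1_foldr_Forall2 Xs psi : free1 (foldr Forall2 psi Xs) = free1 psi.
Proof. by elim: Xs. Qed.

Lemma ndef_closed k (Q : (nat -> nat) -> Prop) : ndef R k (fun rho _ _ => Q rho) ->
  exists psi, free1 psi = [::] /\
    {subset free2 psi <= map nw (iota 0 k)} /\
    forall e E rho, (forall i, i < k -> num (branch (E (nw i))) (rho i)) ->
      sat R e E psi <-> Q rho.
Proof.
move=> [phi hphi].
pose xs := [seq x - 3 | x <- free1 (tr phi)].
have hL e E rho : (forall i, i < k -> num (E (nv i)) (rho i)) ->
    lsat R e E (foldr LAll1 phi xs) <-> Q rho.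
  move=> hE; elim: xs e => [|x xs IH] e; first exact: (hphi e E rho hE).
  by split=> [/(_ 0)/IH|q n]; last exact/IH.
pose psi1 := tr (foldr LAll1 phi xs).
have f1 z : z \in free1 psi1 -> z < 3.
  move=> /free1_foldr_LAll1[z1 z2]; rewrite ltnNge; apply/negP => z3.
  have /z2 : z - 3 \in xs by apply/mapP; exists z.
  by rewrite -addn3 subnK// eqxx.
have h1 e E rho : (forall i, i < k -> num (branch (E (nw i))) (rho i)) ->
    sat R e E psi1 <-> Q rho.
  move=> hE; pose e' x := if x < 3 then e x else pos 0.
  rewrite (@Defs.eq_sat R psi1 e e' E E)//; last by move=> z /f1 z3; rewrite /e' z3.
  by rewrite (@sat_tr R _ (fun=> 0))//; exact: hL.
pose psi2 := Forall1 0 (Forall1 1 (Forall1 2 psi1)).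
have f2 : free1 psi2 = [::].
  case E: (free1 psi2) => [//|z l]; have : z \in free1 psi2 by rewrite E mem_head.
  by rewrite /= !mem_filter => /and4P[z0 z1 z2 /f1]; move: z z0 z1 z2 {E} => [|[|[|]]].
have h2 e E rho : (forall i, i < k -> num (branch (E (nw i))) (rho i)) ->
    sat R e E psi2 <-> Q rho.
  move=> hE; split=> [h|q u v w]; last exact/(h1 _ E rho hE).
  exact: (iffLR (h1 _ E rho hE) (h [::] [::] [::])).
pose Xs := [seq X <- free2 psi2 | X \notin map nw (iota 0 k)].
exists (foldr Forall2 psi2 Xs); split; first by rewrite free1_foldr_Forall2.
split=> [Z /free2_foldr_Forall2[Z1]|e E rho].
  by rewrite mem_filter Z1 andbT negbK.
have : all (fun X => X \notin map nw (iota 0 k)) Xs by exact: filter_all.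
elim: Xs E => [|X Xs IH] E /=; first by move=> _; exact: h2.
move=> /andP[Xk Xsk] hE.
have hE' t i : i < k -> num (branch (update E X t (nw i))) (rho i).
  move=> ik; rewrite /update; case: eqP => [iX|_]; last exact: hE.
  by case/negP: Xk; rewrite -iX; apply: map_f; rewrite mem_iota.
split=> [/(_ (fun=> false))/(IH _ Xsk (hE' _))//|q t].
by apply/(IH _ Xsk (hE' t)).
Qed.
End Closing.

Definition pair_code a m := 2 ^ a * m.*2.+1.

(* The code of [Forall2 X (Or psi phi)] from those of [psi] and [phi]. *)
Definition guard_code X g c :=
  pair_code 6 (pair_code X (pair_code
    (pair_code 4 (pair_code g (pair_code c 0))) 0)).

Lemma godel_guard X psi phi :
  godel (Forall2 X (Or psi phi)) = guard_code X (godel psi) (godel phi).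
Proof. by []. Qed.

Definition computable (F : seq nat -> nat) :=
  exists f, forall xs, computes f xs (F xs).

Lemma computes_Comp1 f g xs y z : computes g xs y -> computes f [:: y] z ->
  computes (Comp f [:: g]) xs z.
Proof. by move=> hg; apply: computes_comp => // -[]. Qed.

Lemma computable_proj i : computable (fun xs => nth 0 xs i).
Proof. by exists (Proj i) => xs; exact: computes_proj. Qed.

Lemma computable_comp (F : nat -> nat) G : computable (fun xs => F (nth 0 xs 0)) ->
  computable G -> computable (fun xs => F (G xs)).
Proof.
move=> [f hf] [g hg]; exists (Comp f [:: g]) => xs.
exact: computes_Comp1 (hg xs) (hf [:: G xs]).
Qed.

Lemma computable_succ F : computable F -> computable (fun xs => (F xs).+1).
Proof.
by apply: (computable_comp (F := S)); exists Succ => xs; exact: computes_succ.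
Qed.

Lemma computable_const c : computable (fun=> c).
Proof.
elim: c => [|c IH]; last exact: computable_succ.
by exists Zero => xs; exact: computes_zero.
Qed.

Lemma computable_iter (F : nat -> nat) G H : computable (fun xs => F (nth 0 xs 0)) ->
  computable G -> computable H -> computable (fun xs => iter (G xs) F (H xs)).
Proof.
move=> [f hf] [g hg] [h hh].
exists (Comp (PrimRec (Proj 0) (Comp f [:: Proj 1])) [:: g; h]) => xs.
apply: (@computes_comp _ _ _ [:: G xs; H xs]) => // [[|[|]]//|].
elim: (G xs) => [|n IH]; first exact/computes_primrec0/computes_proj.
apply: computes_primrecS IH _; apply: computes_Comp1 (computes_proj 1 _) _.
exact: (hf [:: _]).
Qed.

Lemma computable_double F : computable F -> computable (fun xs => (F xs).*2).
Proof.
move=> cF.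
have -> : (fun xs => (F xs).*2) = fun xs => iter (F xs) (fun r => r.+2) 0.
  by apply/funext => xs; elim: (F xs) => //= n <-; rewrite doubleS.
apply: computable_iter cF (computable_const 0).
exact/computable_succ/computable_succ/computable_proj.
Qed.

Lemma computable_pair_code F G : computable F -> computable G ->
  computable (fun xs => pair_code (F xs) (G xs)).
Proof.
move=> cF cG.
have -> : (fun xs => pair_code (F xs) (G xs)) =
    fun xs => iter (F xs) double (G xs).*2.+1.
  apply/funext => xs; rewrite /pair_code; elim: (F xs) => [|n IH] /=.
    by rewrite mul1n.
  by rewrite -IH expnS -mulnA mul2n.
apply: computable_iter cF _; first exact/computable_double/computable_proj.
exact/computable_succ/computable_double.
Qed.

Lemma computable_guard_code X g F : computable F ->
  computable (fun xs => guard_code X g (F xs)).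
Proof.
move=> cF.
by do ?[exact: cF|exact: computable_const|apply: computable_pair_code].
Qed.

Section Numerals.
Context (R : realType).

Definition unary c := free1 c = [::] /\ {subset free2 c <= [:: nw 0]}.

Definition expresses c (Q : nat -> Prop) :=
  forall e E n, num (branch (E (nw 0))) n -> sat R e E c <-> Q n.

Lemma sat_or e E phi psi : sat R e E (Or phi psi) = (sat R e E phi \/ sat R e E psi).
Proof. by []. Qed.

Definition apF i := tr (Lap (nv i)).

Lemma free1_apF i : free1 (apF i) = [::].
Proof. by []. Qed.

Lemma free2_apF i : {subset free2 (apF i) <= [:: nw i]}.
Proof.
apply/allP; rewrite /free2 /=.
by rewrite !inE !eqxx.
Qed.

Lemma sat_apF e E i : sat R e E (apF i) <-> exists n, num (branch (E (nw i))) n.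
Proof.
rewrite (@Defs.eq_sat R (apF i) e (fun=> pos 0) E E)//.
rewrite (@sat_tr R _ (fun=> 0))//; exact: apP.
Qed.


Lemma exists_guard k i (P : (nat -> nat) -> Prop) : i < k ->
  ndef R k (fun rho _ _ => P rho) ->
  exists g, free1 g = [::] /\ {subset free2 g <= map nw (iota 0 k)} /\
    forall e E rho, (forall j, j < k -> j != i -> num (branch (E (nw j))) (rho j)) ->
      sat R e E g <-> ~ exists n, num (branch (E (nw i))) n /\ P (update rho i n).
Proof.
move=> ik dP; have [h [h1 [h2 hsat]]] := ndef_closed (ndef_not dP).
exists (Or (Not (apF i)) h); split.
  by change (free1 (apF i) ++ free1 h = [::]); rewrite free1_apF h1.
split=> [Z|e E rho hE].
  have -> : free2 (Or (Not (apF i)) h) = free2 (apF i) ++ free2 h by [].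
  rewrite mem_cat => /orP[/free2_apF|/h2//]; rewrite inE => /eqP ->.
  by apply: map_f; rewrite mem_iota.
have hE' n : num (branch (E (nw i))) n ->
    forall j, j < k -> num (branch (E (nw j))) (update rho i n j).
  by move=> En j jk; rewrite /update; case: eqP => [->//|/eqP]; exact: hE.
rewrite sat_or; split=> [[nap|hh] [n [En Pn]]|nP].
- by apply: nap; apply/sat_apF; exists n.
- by move/(hsat _ _ _ (hE' n En)): hh.
- case: (pselect (exists n, num (branch (E (nw i))) n)) => [[n En]|nE].
    by right; apply/(hsat _ _ _ (hE' n En)) => Pn; apply: nP; exists n.
  by left => /sat_apF.
Qed.

Lemma branch_num n : exists t, num (branch t) n.
Proof.
have [t tE] := branch_surj (fun i => i == 0 %[mod n.+1]).
by exists t; rewrite tE; exact: num_exists.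
Qed.

Lemma sat_guarded e E X g c :
  sat R e E (Forall2 X (Or g c)) =
  forall t, sat R e (update E X t) g \/ sat R e (update E X t) c.
Proof. by []. Qed.

Lemma exists_at_zero : exists g, let Z c := Forall2 (nw 0) (Or g c) in
  (forall c, unary c -> sentence (Z c)) /\
  forall c Q, expresses c Q -> forall e E, sat R e E (Z c) <-> Q 0.
Proof.
have [g [g1 [g2 hg]]] := exists_guard (ltnSn 0) (ndef_zero R (ltnSn 0)).
exists g; split=> [c [c1 c2]|c Q cQ e E].
  rewrite /sentence [free1 _]/= g1 c1 /=.
  case E: [seq _ <- _ | _] => [//|Z l].
  have : Z \in [seq Y <- free2 g ++ free2 c | Y != nw 0] by rewrite E mem_head.
  rewrite mem_filter mem_cat => /andP[Z0 /orP[/g2|/c2]]; rewrite inE => /eqP ZE.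
    by rewrite ZE eqxx in Z0.
  by rewrite ZE eqxx in Z0.
rewrite sat_guarded.
have hg' t := hg e (update E (nw 0) t) (fun=> 0).
split=> [h|q0 t].
  have [t tn] := branch_num 0; have [|/cQ] := h t; last first.
    by apply; rewrite update_same.
  move/hg' => [[]//|]; exists 0; split; first by rewrite update_same.
  by rewrite update_same.
have [gt|ngt] := pselect (sat R e (update E (nw 0) t) g); first by left.
right; have [n [tn]] : exists n, num (branch (update E (nw 0) t (nw 0))) n /\
    update (fun=> 0) 0 n 0 = 0.
  by apply: contrapT => h; apply: ngt; apply/hg' => // -[].
rewrite update_same => n0; subst n; exact/(cQ _ _ _ tn).
Qed.

(* [S] turns [Q n] into [Q n.+1], so that [iter n S] followed by [exists_at_zero]
   substitutes the numeral [n], with an effect on codes that is an iteration. *)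
Lemma exists_shift : exists g1 g2,
  let S c := Forall2 (nw 1) (Or g1 (Forall2 (nw 0) (Or g2 c))) in
  (forall c, unary c -> unary (S c)) /\
  forall c Q, expresses c Q -> expresses (S c) (fun n => Q n.+1).
Proof.
have [g1 [g11 [g12 h1]]] := exists_guard (ltnSn 1)
  (ndef_succ R (isT : 0 < 2) (isT : 1 < 2)).
have [g2 [g21 [g22 h2]]] := exists_guard (isT : 0 < 2)
  (ndef_eq R (isT : 0 < 2) (isT : 1 < 2)).
exists g1, g2; split=> [c [c1 c2]|c Q cQ e E n En].
  split; first by rewrite [LHS]/= g11 g21 c1.
  move=> Z; rewrite [free2 _]/= mem_filter mem_cat mem_filter mem_cat.
  move=> /andP[Z1 /orP[/g12|/andP[Z0 /orP[/g22|/c2//]]]]; rewrite !inE.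
    by rewrite (negPf Z1) orbF.
  by rewrite (negPf Z1) orbF.
change (sat R e E (Forall2 (nw 1) (Or g1 (Forall2 (nw 0) (Or g2 c)))) <-> Q n.+1).
rewrite sat_guarded.
have h1' t := h1 e (update E (nw 1) t) (fun=> n).
have h2' t u m := h2 e (update (update E (nw 1) t) (nw 0) u) (fun=> m).
have E1 t : update E (nw 1) t (nw 1) = t by rewrite update_same.
have E0 t u : update (update E (nw 1) t) (nw 0) u (nw 1) = t by [].
have Eu t u : update (update E (nw 1) t) (nw 0) u (nw 0) = u by rewrite update_same.
split=> [h|q t].
  have [t tn] := branch_num n.+1; have [|] := h t.
    move/h1' => []; first by case=> [|[]].
    by exists n.+1; rewrite E1 update_same; split.
  rewrite sat_guarded => /(_ t) [|/cQ]; last by apply; rewrite Eu.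
  move/(h2' _ _ n.+1) => []; first by case=> [//|[|//]] _ _; rewrite E0.
  by exists n.+1; rewrite Eu update_same; split.
have [gt|ngt] := pselect (sat R e (update E (nw 1) t) g1); first by left.
right; have [m [tm mn]] : exists m, num (branch (update E (nw 1) t (nw 1))) m /\
    update (fun=> n) 1 m 1 = (update (fun=> n) 1 m 0).+1.
  by apply: contrapT => hh; apply: ngt; apply/h1' => // -[|[]].
have {}mn : m = n.+1 by move: mn; rewrite update_same.
subst m.
rewrite sat_guarded => u.
have [gu|ngu] := pselect (sat R e (update (update E (nw 1) t) (nw 0) u) g2); first by left.
right; have [m [um mn]] : exists m,
    num (branch (update (update E (nw 1) t) (nw 0) u (nw 0))) m /\
    update (fun=> n.+1) 0 m 0 = update (fun=> n.+1) 0 m 1.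
  apply: contrapT => hh; apply: ngu; apply/(h2' _ _ n.+1) => //.
  by case=> [//|[|//]] _ _; rewrite E0.
have {}mn : m = n.+1 by move: mn; rewrite update_same.
subst m; exact/(cQ _ _ _ um).
Qed.

End Numerals.

Theorem theorem7p1 (R : realType) : ~ decidable_theory (theory R).
Proof.
move=> [f hf].
have [g0 hZ] := exists_at_zero R; have [g1 [g2 hS]] := exists_shift R.
pose Z c := Forall2 (nw 0) (Or g0 c).
pose S c := Forall2 (nw 1) (Or g1 (Forall2 (nw 0) (Or g2 c))).
have [Zsent Zsat] : (forall c, unary c -> sentence (Z c)) /\
  forall c Q, expresses R c Q -> forall e E, sat R e E (Z c) <-> Q 0 := hZ.
have [Sun Ssat] : (forall c, unary c -> unary (S c)) /\
  forall c Q, expresses R c Q -> expresses R (S c) (fun n => Q n.+1) := hS.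
pose s c := guard_code (nw 1) (godel g1) (guard_code (nw 0) (godel g2) c).
pose z c := guard_code (nw 0) (godel g0) c.
have godel_inst n c : godel (Z (iter n S c)) = z (iter n s (godel c)).
  rewrite godel_guard -/(z _); congr z; elim: n => [//|n IH].
  by rewrite !iterS -IH /S !godel_guard.
have [d hd] : computable (fun xs => z (iter (nth 0 xs 0) s (nth 0 xs 0))).
  apply: (computable_comp (F := z)).
    exact/computable_guard_code/computable_proj.
  apply: computable_iter; try exact: computable_proj.
  exact/computable_guard_code/computable_guard_code/computable_proj.
pose Q n := exists y, y = 0 /\ computes (Comp f [:: d]) [:: n] y.
have QE n y : computes f [:: z (iter n s n)] y ->
    computes (Comp f [:: d]) [:: n] y.
  by apply: computes_Comp1; exact: hd [:: n].
have [a [a1 [a2 ha]]] : exists a, free1 a = [::] /\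
    {subset free2 a <= map nw (iota 0 1)} /\
    forall e E rho, (forall i, i < 1 -> num (branch (E (nw i))) (rho i)) ->
      sat R e E a <-> Q (rho 0).
  apply: ndef_closed.
  pose P (rho : nat -> nat) (U V : nat -> bool) y :=
    y = 0 /\ computes (Comp f [:: d]) [:: rho 0] y.
  apply: (@ndef_ex R 1 P) => //; apply: ndef_and; first exact: ndef_zero.
  exact: (@computes_ndef R _ 2 [:: 0] 1).
have aQ : expresses R a Q.
  by move=> e E n En; apply: (ha e E (fun=> n)) => -[].
have au : unary a by [].
pose m := godel a; pose sigma := Z (iter m S a).
have sigma_sent : sentence sigma.
  have iSun n : unary (iter n S a) by elim: n => //= n; exact: Sun.
  exact: Zsent.
have sigma_sat e E : sat R e E sigma <-> Q m.
  have iS n : expresses R (iter n S a) (fun k => Q (n + k)).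
    elim: n => [|n IH] //= e' E' k Ek; rewrite addSnnS.
    exact: Ssat IH e' E' k Ek.
  by rewrite (Zsat _ _ (iS m)) addn0.
have code_sigma : z (iter m s m) = godel sigma by rewrite godel_inst.
have [yes no] := hf (godel sigma).
have [Qm|nQ] := pselect (Q m).
  have th : [set godel phi | phi in theory R] (godel sigma).
    exists sigma; last exact: erefl.
    by split; [exact: sigma_sent|move=> e E; exact/sigma_sat].
  have := QE m 1; rewrite code_sigma => /(_ (yes th)) h1.
  have [_ [-> h0]] := Qm.
  by have := computes_functional h0 h1.
have nth : ~ [set godel phi | phi in theory R] (godel sigma).
  move=> [phi [_ sphi]] /godel_inj E; apply: nQ.
  by rewrite -(sigma_sat (fun=> [::]) (fun _ _ => false)) -E.
have := QE m 0; rewrite code_sigma => /(_ (no nth)) h0.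
by apply: nQ; exists 0.
Qed.
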